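(* Let $G=(V,E)$ be a finite simple graph with a fixed orientation $\vec E$, and let $H$ be a real symmetric matrix strictly supported on $G$. Let $\lambda_k=\lambda_k(H)$ be a simple eigenvalue of $H$ with eigenvector $\psi$ that has no zero entries. Then the function $\Lambda(\alpha)=\lambda_k(H_\alpha)$, $\alpha\in C^1(G,\mathbb R)$, has a critical point at $\alpha=0$. Its Hessian at this point, $\operatorname{Hess}\Lambda: C^1(G,\mathbb R)\times C^1(G,\mathbb R)\to\mathbb R$, is a bilinear form on $C^1(G,\mathbb R)$ given by the dual form $\mathcal X_r^\sharp$ of the weighted cycle intersection form via $$\tfrac12\operatorname{Hess}\Lambda(\alpha_1,\alpha_2)=\mathcal X_r^\sharp\big([\alpha_1],[\alpha_2]\big),\qquad r_e=-(\psi_uH_{u,v}\psi_v)^{-1}\ \text{ for } e=(u,v)\in\vec E,$$ where $[\alpha]\in H^1(G,\mathbb R)$ denotes the equivalence class of $\alpha\in C^1(G,\mathbb R)$. In coordinates, if $C$ is a frame for the cycle space $Z$, the Hessian is given by the matrix $C(C^\top RC)^{-1}C^\top$, i.e. $$\tfrac12\operatorname{Hess}\Lambda(\alpha_1,\alpha_2)=\big\langle\alpha_1,\,C(C^\top RC)^{-1}C^\top\alpha_2\big\rangle_{\mathbb R^{\vec E}},$$ where $R=\operatorname{diag}(r_e)$ is the diagonal matrix of the weights $r_e$ and the inner product is the standard inner product on $C^1(G,\mathbb R)=\mathbb R^{\vec E}$.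
   Context: Let $G=(V,E)$ be a finite simple graph; $u\sim v$ means $\{u,v\}\in E$. An orientation $\vec E$ contains exactly one of $(u,v)$, $(v,u)$ for each edge $\{u,v\}\in E$. A real symmetric matrix $H$ indexed by $V$ is strictly supported on $G$ if for $u\ne v$: $H_{u,v}\ne0$ if and only if $u\sim v$. Eigenvalues of a Hermitian matrix are ordered $\lambda_1\le\lambda_2\le\dots\le\lambda_{|V|}$ with multiplicity. Eigenvectors of $H$ are taken with real entries, so that the edge weights $r_e$ are real. Chains: $C_1(G,\mathbb R)=\{\sum_{e\in\vec E}y_ee : y_e\in\mathbb R\}\simeq\mathbb R^{\vec E}$. The cycle space $Z=H_1(G,\mathbb R)$ is the set of $y\in C_1(G,\mathbb R)$ with $\sum_{v:(v,u)\in\vec E}y_{(v,u)}=\sum_{w:(u,w)\in\vec E}y_{(u,w)}$ for every $u\in V$; $\beta=\dim Z=|E|-|V|+c(G)$, where $c(G)$ is the number of connected components. A frame for $Z$ is any $|\vec E|\times\beta$ matrix whose columns form a basis of $Z$. Cochains: $C^1(G,\mathbb R)=\mathbb R^{\vec E}$ is the space of functions $\vec E\to\mathbb R$; $\alpha\in C^1(G,\mathbb R)$ is extended antisymmetrically, $\alpha_{u,v}=\alpha(e)$ if $e=(u,v)\in\vec E$ and $\alpha_{u,v}=-\alpha(e)$ if $e=(v,u)\in\vec E$. The coboundary $d:\mathbb R^V\to C^1(G,\mathbb R)$ is $(d\theta)_{u,v}=\theta_v-\theta_u$. $H^1(G,\mathbb R)=C^1(G,\mathbb R)/\operatorname{Ran}d$.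 The pairing $\alpha\cdot y=\sum_{e\in\vec E}\alpha(e)y_e$ descends to a non-degenerate pairing between $H^1(G,\mathbb R)$ and $Z=H_1(G,\mathbb R)$, by which $H^1(G,\mathbb R)$ is identified with the dual space of $Z$. Magnetic operator: $(H_\alpha)_{u,v}=e^{i\alpha_{u,v}}H_{u,v}$ for $u\sim v$; all other entries (in particular diagonal ones) are those of $H$. The Hessian at $0$ is $\operatorname{Hess}\Lambda(\alpha_1,\alpha_2)=\frac{\partial^2}{\partial t_1\partial t_2}\Lambda(t_1\alpha_1+t_2\alpha_2)\big|_{t_1=t_2=0}$. Weighted cycle intersection form: $\mathcal X_r$ is the restriction to $Z$ of the bilinear form $\mathcal R(y,y')=\sum_{e\in\vec E}r_ey_ey'_e$ on $C_1(G,\mathbb R)$. For the weights in the claim, with $\lambda_k$ simple, $\mathcal X_r$ is non-degenerate. Dual form: for a non-degenerate symmetric bilinear form $\mathcal B$ on a finite-dimensional vector space $W$ and $f\in W^*$, $f^\sharp\in W$ is defined by $f\cdot w=\mathcal B(f^\sharp,w)$ for all $w\in W$, and the dual form on $W^*$ is $\mathcal B^\sharp(f_1,f_2)=\mathcal B(f_1^\sharp,f_2^\sharp)$.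
   Formalization: The eigenvector ψ is assumed to be a unit vector; without this the formula is false, since the weights r_e depend on the scaling of ψ while the Hessian does not (triangle, H = −adjacency, ψ = (1,1,1) gives flux²/3 instead of flux²/9). *)

(* Defs.v *)
(* The real numbers are an abstract [R : realType] and the complex numbers are
   [R[i]]. *)
From HB Require Import structures.
From mathcomp Require Import all_boot all_order all_algebra.
From mathcomp Require Import generic_quotient.
From mathcomp Require Import all_classical all_reals all_analysis.
From mathcomp Require Import complex.
Import Order.TTheory GRing.Theory Num.Theory.
Import numFieldNormedType.Exports.

Set Implicit Arguments.
Unset Strict Implicit.
Unset Printing Implicit Defensive.

Local Open Scope ring_scope.
Local Open Scope complex_scope.
Local Open Scope quotient_scope.

Definition dotv (R : pzRingType) (m : nat) (x y : 'cV[R]_m) : R :=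
  \sum_i x i 0 * y i 0.

Lemma dotv_linear (R : comNzRingType) (m : nat) (x : 'cV[R]_m) :
  linear_for *%R (dotv x).
Proof.
move=> a y z; rewrite /dotv mulr_sumr -big_split /=; apply: eq_bigr => i _.
by rewrite !mxE mulrDr mulrCA.
Qed.

(* The vertex set is 'I_n and [e] is the adjacency relation. *)
Definition simple_graph (n : nat) (e : rel 'I_n) : Prop :=
  symmetric e /\ irreflexive e.

Definition orientation (n : nat) (e : rel 'I_n) (O : {set 'I_n * 'I_n}) : Prop :=
  (forall u v, (u, v) \in O -> e u v) /\
  (forall u v, e u v -> ((u, v) \in O) (+) ((v, u) \in O)).

Definition strictly_supported (R : pzRingType) (n : nat) (e : rel 'I_n)
    (H : 'M[R]_n) : Prop :=
  forall u v, u != v -> (H u v != 0) = e u v.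

Section OrientedGraph.

Variables (R : realType) (n : nat) (O : {set 'I_n * 'I_n}).

(* The oriented edges are indexed by 'I_#|O|; both 1-chains and 1-cochains are
   column vectors with this index set. *)
Definition tail (i : 'I_#|O|) : 'I_n := (enum_val i).1.
Definition head (i : 'I_#|O|) : 'I_n := (enum_val i).2.

Definition boundary (y : 'cV[R]_#|O|) : 'cV[R]_n :=
  \col_u (\sum_(i | head i == u) y i 0 - \sum_(i | tail i == u) y i 0).

Definition coboundary (theta : 'cV[R]_n) : 'cV[R]_#|O| :=
  \col_i (theta (head i) 0 - theta (tail i) 0).

Lemma boundary_linear : linear boundary.
Proof.
move=> a x y; apply/colP => u; rewrite !mxE.
under eq_bigr do rewrite !mxE.
under [X in _ - X]eq_bigr do rewrite !mxE.
by rewrite !big_split /= -!mulr_sumr mulrBr opprD addrACA.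
Qed.
HB.instance Definition _ :=
  GRing.isLinear.Build R 'cV[R]_#|O| 'cV[R]_n *:%R boundary boundary_linear.

Lemma coboundary_linear : linear coboundary.
Proof. by move=> a x y; apply/colP => i; rewrite !mxE mulrBr opprD addrACA. Qed.
HB.instance Definition _ :=
  GRing.isLinear.Build R 'cV[R]_n 'cV[R]_#|O| *:%R coboundary coboundary_linear.

Definition cycle_space : {vspace 'cV[R]_#|O|} := lker (linfun boundary).

Lemma mem_cycle_space (y : 'cV[R]_#|O|) :
  y \in cycle_space <->
  forall u, \sum_(i | head i == u) y i 0 = \sum_(i | tail i == u) y i 0.
Proof.
rewrite memv_ker lfunE /=; split=> [/eqP y0 u | yZ].
  by move/colP/(_ u)/eqP: y0; rewrite !mxE subr_eq0 => /eqP.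
by apply/eqP/colP => u; rewrite !mxE yZ subrr.
Qed.

Definition cohomology1 : zmodType := Quotient.quot (limg (linfun coboundary)).

Definition coho_class (alpha : 'cV[R]_#|O|) : cohomology1 := \pi alpha.

Definition pairing (alpha : 'cV[R]_#|O|) (z : subvs_of cycle_space) : R^o :=
  dotv alpha (vsval z).

Lemma pairing_linear (alpha : 'cV[R]_#|O|) : linear (pairing alpha).
Proof. by move=> a y z; rewrite /pairing linearP /= dotv_linear. Qed.
HB.instance Definition _ (alpha : 'cV[R]_#|O|) :=
  GRing.isLinear.Build R (subvs_of cycle_space) R^o *:%R (pairing alpha)
    (pairing_linear alpha).

(* The identification of the first cohomology with the dual of the cycle space,
   computed on a representative; [coho_dualE] shows that the choice of the
   representative is irrelevant. *)
Definition coho_dual (c : cohomology1) : 'Hom(subvs_of cycle_space, R^o) :=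
  linfun (pairing (repr c)).

Lemma dotv_coboundary (theta : 'cV[R]_n) (y : 'cV[R]_#|O|) :
  dotv (coboundary theta) y = dotv theta (boundary y).
Proof.
have E (f : 'I_#|O| -> 'I_n) :
    \sum_i theta (f i) 0 * y i 0
    = \sum_u theta u 0 * (\sum_(i | f i == u) y i 0).
  rewrite (partition_big f predT) //=; apply: eq_bigr => u _.
  by rewrite mulr_sumr; apply: eq_bigr => i /eqP ->.
rewrite /dotv; under eq_bigr do rewrite mxE mulrBl.
under [RHS]eq_bigr do rewrite mxE mulrBr.
by rewrite !sumrB !E.
Qed.

Lemma coho_dualE (alpha : 'cV[R]_#|O|) (z : subvs_of cycle_space) :
  coho_dual (coho_class alpha) z = dotv alpha (vsval z).
Proof.
rewrite lfunE /= /pairing; set c := coho_class alpha.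
have: alpha - repr c \in limg (linfun coboundary).
  by rewrite Quotient.idealrBE reprK.
case/memv_imgP => theta _; rewrite lfunE /= => dtheta.
have -> : alpha = coboundary theta + repr c by rewrite -dtheta subrK.
apply/esym; have {1}-> : dotv (coboundary theta + repr c) (vsval z)
    = dotv (coboundary theta) (vsval z) + dotv (repr c) (vsval z).
  by rewrite /dotv -big_split; apply: eq_bigr => i _; rewrite mxE mulrDl.
rewrite dotv_coboundary; have := subvsP z.
rewrite memv_ker lfunE /= => /eqP ->.
by rewrite /dotv big1 ?add0r // => i _; rewrite mxE mulr0.
Qed.

Definition frame (C : 'M[R]_(#|O|, \dim cycle_space)) : Prop :=
  basis_of cycle_space [tuple col j C | j < \dim cycle_space].

(* Antisymmetric extension of a cochain to pairs of vertices; as [O] is an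
   orientation of a simple graph, at most one of the two sums has a term. *)
Definition cochain_ext (alpha : 'cV[R]_#|O|) (u v : 'I_n) : R :=
  \sum_(i | enum_val i == (u, v)) alpha i 0
  - \sum_(i | enum_val i == (v, u)) alpha i 0.

Definition magnetic (e : rel 'I_n) (H : 'M[R]_n) (alpha : 'cV[R]_#|O|) :
    'M[R[i]]_n :=
  \matrix_(u, v)
    if e u v then
      (cos (cochain_ext alpha u v) +i* sin (cochain_ext alpha u v)) * (H u v)%:C
    else (H u v)%:C.

(* Not invariant under rescaling of [psi]: meant for a unit vector [psi]. *)
Definition edge_weight (H : 'M[R]_n) (psi : 'cV[R]_n) : 'rV[R]_#|O| :=
  \row_i - (psi (tail i) 0 * H (tail i) (head i) * psi (head i) 0)^-1.

Definition cycle_intersection_form (r : 'rV[R]_#|O|)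
    (y y' : subvs_of cycle_space) : R :=
  \sum_i r 0 i * vsval y i 0 * vsval y' i 0.

End OrientedGraph.

(* The eigenvalues of a Hermitian matrix in nondecreasing order, repeated
   according to multiplicity: the roots of the characteristic polynomial are
   real, so taking real parts loses nothing. *)
Definition eigenvalues (R : realType) (n : nat) (A : 'M[R[i]]_n) : seq R :=
  sort <=%O [seq complex.Re z | z <- sval (closed_field_poly_normal (char_poly A))].

(* Numbered from 0, hence meant for k < n. *)
Definition eigenvalue_nth (R : realType) (n k : nat) (A : 'M[R[i]]_n) : R :=
  (eigenvalues A)`_k.

Section DualForm.

Variables (R : realType) (W : vectType R) (B : W -> W -> R).

Definition nondegenerate_form : Prop :=
  forall x, (forall w, B x w = 0) -> x = 0.

(* The element representing [f], which exists and is unique when [B] is a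
   non-degenerate bilinear form (and is junk otherwise). *)
Definition sharp (f : 'Hom(W, R^o)) : W :=
  xget 0 [set x : W | forall w, f w = B x w]%classic.

Definition dual_form (f1 f2 : 'Hom(W, R^o)) : R := B (sharp f1) (sharp f2).

End DualForm.

Section Hessian.

Variables (R : realType) (m : nat) (F : 'cV[R]_m -> R).

Definition critical_point (x : 'cV[R]_m) : Prop :=
  differentiable F x /\ 'd F x = (fun=> 0) :> ('cV[R]_m -> R).

Definition partial2 (a1 a2 : 'cV[R]_m) (t1 : R) : R :=
  derive1 (fun t2 : R => F (t1 *: a1 + t2 *: a2)) 0.

Definition hessian0 (a1 a2 : 'cV[R]_m) : R := derive1 (partial2 a1 a2) 0.

(* [derive1] is total; this says that the iterated derivative really exists. *)
Definition hessian0_exists (a1 a2 : 'cV[R]_m) : Prop :=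
  (\forall t1 \near (0 : R),
     derivable (fun t2 : R => F (t1 *: a1 + t2 *: a2)) 0 1) /\
  derivable (partial2 a1 a2) 0 1.

End Hessian.

(* Main.v *)
Require Import Defs.
From mathcomp Require Import all_boot all_order all_algebra.
From mathcomp Require Import all_classical all_reals all_analysis.
From mathcomp Require Import complex.
From mathcomp Require Import ring lra.
Import Order.TTheory GRing.Theory Num.Theory.
Import numFieldNormedType.Exports.
Set Implicit Arguments.
Unset Strict Implicit.
Unset Printing Implicit Defensive.
Local Open Scope classical_set_scope.
Local Open Scope ring_scope.

(** Write Lambda(alpha) for the ordered eigenvalue of the magnetic operator
    H_alpha and psi for the real unit eigenvector of H.

    Regularity.  Weyl's inequality ([weyl_entries]) makes Lambda, the eigenvalue
    of fixed rank k, Lipschitz.  Since lambda is simple, H - lambda + psi psi^T is invertible ([regularized_unit]); hence, for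
    small alpha, the eigenvector phi_alpha can be normalized by
    <psi, phi_alpha> = 1 and depends on alpha in a Lipschitz way
    ([eigenvector_lipschitz]).  As H_alpha is Hermitian, the exact identity
      (Lambda(beta) - Lambda(alpha)) <phi_alpha, phi_beta>
        = <phi_alpha, (H_beta - H_alpha) phi_beta>
    ([eigenvalue_difference]) then gives every derivative that is needed:
    - with alpha = 0, the bound |Lambda(beta) - Lambda(0)| <= c |beta|^2, because
      the first-order part of H_beta is i times an antisymmetric real matrix,
      whose quadratic form vanishes on the real vector psi; so 0 is critical;
    - at each small alpha, the directional derivative
      <phi_alpha, B_alpha phi_alpha> / |phi_alpha|^2, where B_alpha is the
      derivative of the operator in the given direction.
    Differentiating the last expression once more at 0 would bring in the
    derivative of phi_alpha, unless B_0 psi = 0: then only the derivative of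
    B_alpha contributes ([is_derive_expectation]).

    Choice of gauge.  For a direction a2, the condition B_0 psi = 0 says that
    the chain with coefficients - psi_u H_uv psi_v a2_uv is a cycle, in other
    words that a2 = R z with z in Z.  Every cochain is of the form
    R z + d theta with z in Z ([weighted_hodge]): the equation for theta is
    (H - lambda)(psi theta) = w with w orthogonal to psi, and is solvable since
    lambda is simple.  Adding d theta conjugates H_alpha by a diagonal unitary
    matrix and leaves Lambda unchanged ([magnetic_gauge]).  What remains is
      Hess(a1, a2) = - sum_(u,v) psi_u H_uv psi_v a1_uv (R z)_uv = 2 (a1 . z),
    which is [hessian_cycle].

    Dual form.  If a = R z + d theta with z in Z, then a . w = X_r(z, w) for all
    cycles w, so z represents the class of a.  Therefore
    X_r^sharp([a1], [a2]) = X_r(z1, z2) = (R z1) . z2 = a1 . z2.  The same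
    decomposition shows that X_r is non-degenerate: if z in Z and R z
    annihilates Z, write z itself as R w + d theta; then z . z = (R z) . w = 0.
    Finally, in a frame C, z2 = C c with C^T R C c = C^T a2.

    The perturbation argument is carried out over the reals, with the complex
    n x n matrix A + i B replaced by the real block matrix [A, -B; B, A]. *)

(** * Ordered eigenvalues of Hermitian matrices *)

Lemma char_poly_similar (K : fieldType) n (P A B : 'M[K]_n) :
  P \in unitmx -> P *m A = B *m P -> char_poly A = char_poly B.
Proof.
move=> Pu PAB; pose p := map_mx polyC P.
have E : p *m char_poly_mx A = char_poly_mx B *m p.
  rewrite /char_poly_mx mulmxBr mulmxBl -!map_mxM PAB.
  by rewrite mul_scalar_mx mul_mx_scalar.
have := congr1 determinant E; rewrite !det_mulmx mulrC => /mulIf; apply.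
by rewrite det_map_mx polyC_eq0 -unitfE -unitmxE.
Qed.

Section HermitianSpectrum.

Local Open Scope complex_scope.

Variables (R : realType) (n : nat).
Local Notation C := R[i].
Implicit Types (A B : 'M[C]_n) (v : 'rV[C]_n).

Definition conj_symmetric A := forall i j, A i j = Num.conj (A j i).

Lemma hermitian_normal A : conj_symmetric A -> A \is hermsymmx.
Proof.
move=> hA; apply/is_hermitianmxP; rewrite expr0 scale1r.
by apply/matrixP => i j; rewrite !mxE hA.
Qed.

Lemma char_poly_spectral A : conj_symmetric A ->
  char_poly A = \prod_(i < n) ('X - (spectral_diag A 0 i)%:P).
Proof.
move=> /hermitian_normal/hermitian_normalmx/orthomx_spectralP.
set P := spectralmx A; set d := spectral_diag A => AE.
rewrite (@char_poly_similar _ _ P A (diag_mx d)); last 2 first.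
- exact: spectral_unit.
- by rewrite AE -mulmxA mulKVmx ?spectral_unit.
rewrite char_poly_trig ?diag_mx_is_trig //.
by apply: eq_bigr => i _; rewrite !mxE eqxx mulr1n.
Qed.

(** The eigenvalues in the order of the spectral theorem, which need not be
    increasing. *)
Definition real_spectrum A (i : 'I_n) : R := complex.Re (spectral_diag A 0 i).

Lemma real_spectrumE A i : conj_symmetric A ->
  (real_spectrum A i)%:C = spectral_diag A 0 i.
Proof.
move=> /hermitian_normal/hermitian_spectral_diag_real/mxOverP/(_ 0 i).
exact: RRe_real.
Qed.

Lemma perm_eigenvalues A : conj_symmetric A ->
  perm_eq (eigenvalues A) [seq real_spectrum A i | i <- enum 'I_n].
Proof.
move=> hA; rewrite /eigenvalues; case: closed_field_poly_normal => s /= sE.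
rewrite perm_sort (map_comp (@complex.Re R) (spectral_diag A 0)); apply: perm_map.
move: sE; rewrite (monicP (char_poly_monic A)) scale1r.
rewrite (char_poly_spectral hA) -big_enum /= -(big_map _ xpredT (fun z => 'X - z%:P)).
by move=> /prod_XsubC_eq; rewrite perm_sym.
Qed.

Lemma size_eigenvalues A : conj_symmetric A -> size (eigenvalues A) = n.
Proof. by move=> /perm_eigenvalues/perm_size->; rewrite size_map size_enum_ord. Qed.

Lemma sorted_eigenvalues A : sorted <=%O (eigenvalues A).
Proof. exact/sort_sorted/le_total. Qed.

Lemma count_eigenvalues A (p : pred R) : conj_symmetric A ->
  count p (eigenvalues A) = #|[pred i | p (real_spectrum A i)]|.
Proof.
move=> /perm_eigenvalues/permP->; rewrite count_map cardE.
rewrite -size_filter /enum_mem -filter_predI; congr size.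
by apply: eq_filter => i /=; rewrite andbT.
Qed.

(** The Hermitian form of A, on row vectors, as in the spectral theorem. *)
Definition qform A v : C := (v *m A *m v ^t*)%sesqui 0 0.

Lemma qform_spectral A v : conj_symmetric A ->
  qform A v = \sum_i (real_spectrum A i)%:C * `|(v *m (spectralmx A) ^t*)%sesqui 0 i| ^+ 2.
Proof.
move=> hA; have /hermitian_normal/hermitian_normalmx/orthomx_spectralP AE := hA.
rewrite /qform {1}AE invmx_unitary ?spectral_unitarymx //.
set P := spectralmx A; rewrite !mulmxA -(mulmxA (_ *m diag_mx _)).
have -> : (P *m v^t* = (v *m P^t*)^t*)%sesqui.
  by rewrite trmx_mul map_mxM map_trmx trmxK map_mxCK.
move: (v *m _)%sesqui => c; rewrite mxE; apply: eq_bigr => i _.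
by rewrite mul_mx_diag !mxE real_spectrumE // normCK [RHS]mulrC mulrAC.
Qed.

Lemma qform1_unitary (P : 'M[C]_n) v : P \is unitarymx ->
  qform 1%:M v = \sum_i `|(v *m P^t*)%sesqui 0 i| ^+ 2.
Proof.
move=> uP; rewrite /qform mulmx1.
rewrite -{1}(mulmxKtV v uP erefl) -(mulmxA (v *m _)). have -> : (P *m v^t* = (v *m P^t*)^t*)%sesqui.
  by rewrite trmx_mul map_mxM map_trmx trmxK map_mxCK.
move: (v *m _)%sesqui => c.
by rewrite mxE; apply: eq_bigr => i _; rewrite !mxE normCK.
Qed.

(** The dimension count behind the min-max principle.  If B had fewer eigenvalues
    up to y than A has up to x, some nonzero vector would lie in the span of the
    lower eigenvectors of A and be orthogonal to the lower eigenvectors of B; on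
    it the form of A - x is nonpositive while that of B - y is positive. *)
Lemma leq_count_eigenvalues A B (x y : R) : conj_symmetric A -> conj_symmetric B ->
  (forall v, qform B v - y%:C * qform 1%:M v <= qform A v - x%:C * qform 1%:M v) ->
  (count (<= x)%R (eigenvalues A) <= count (<= y)%R (eigenvalues B))%N.
Proof.
move=> hA hB AB; rewrite !count_eigenvalues // leqNgt; apply/negP.
set J := [pred j | _]; set I := [pred i | _] => JI.
pose PA := (spectralmx A)^t*%sesqui; pose PB := (spectralmx B)^t*%sesqui.
pose f (i : 'I_#|predC I|) := enum_val i; pose g (j : 'I_#|J|) := enum_val j.
pose N := row_mx (colsub f PA) (colsub g PB).
have : kermx N != 0.
  (* There are fewer linear conditions than coordinates. *)
  rewrite kermx_eq0 /row_free neq_ltn; apply/orP; left.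
  apply: leq_ltn_trans (rank_leq_col _) _.
  have := cardC I; rewrite card_ord => nE; rewrite -[X in (_ < X)%N]nE.
  by rewrite [X in (_ < X)%N]addnC ltn_add2l.
case/rowV0Pn => v /sub_kermxP; rewrite mul_mx_row.
move=> vN v0; have {vN} [vA vB] : v *m colsub f PA = 0 /\ v *m colsub g PB = 0.
  by apply/eq_row_mx; rewrite vN row_mx0.
have {}vA i : ~~ (real_spectrum A i <= x) -> (v *m PA) 0 i = 0.
  move=> iI; have iC : i \in predC I by [].
  have := congr1 (fun M : 'rV_#|predC I| => M 0 (enum_rank_in iC i)) vA.
  by rewrite mulmx_colsub mxE /f enum_rankK_in // => ->; rewrite mxE.
have {}vB i : (real_spectrum B i <= y) -> (v *m PB) 0 i = 0.
  move=> iI; have iC : i \in J by [].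
  have := congr1 (fun M : 'rV_#|J| => M 0 (enum_rank_in iC i)) vB.
  by rewrite mulmx_colsub mxE /g enum_rankK_in // => ->; rewrite mxE.
have qB0 : 0 < qform B v - y%:C * qform 1%:M v.
  have PBv : v *m PB != 0.
    apply: contra v0 => /eqP vPB0.
    by rewrite -(mulmxKtV v (spectral_unitarymx B) erefl) -/PB vPB0 mul0mx.
  rewrite qform_spectral // (qform1_unitary v (spectral_unitarymx B)) mulr_sumr -sumrB.
  have [j cj] : exists j, (v *m PB) 0 j != 0.
    exact/rV0Pn/PBv.
  rewrite (bigD1 j) //= -mulrBl -rmorphB ltr_wpDr //.
    apply: sumr_ge0 => i _; rewrite -mulrBl -rmorphB -/PB.
    case: (leP (real_spectrum B i) y) => [/vB-> | /ltW yi].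
      by rewrite normr0 expr0n mulr0.
    by rewrite mulr_ge0 ?exprn_ge0 // ler0c subr_ge0.
  rewrite mulr_gt0 ?exprn_gt0 ?normr_gt0 // ltcR subr_gt0 ltNge.
  by apply: contra cj => /vB ->.
have qA0 : qform A v - x%:C * qform 1%:M v <= 0.
  rewrite qform_spectral // (qform1_unitary v (spectral_unitarymx A)) mulr_sumr -sumrB.
  apply: sumr_le0 => i _; rewrite -mulrBl -rmorphB -/PA.
  case: (boolP (real_spectrum A i <= x)) => [ix|/vA->]; last first.
    by rewrite normr0 expr0n mulr0.
  by rewrite mulr_le0_ge0 ?exprn_ge0 // -[0]/(0%:C) lecR subr_le0.
by have := lt_le_trans qB0 (le_trans (AB v) qA0); rewrite ltxx.
Qed.

Lemma eigenvalue_nth_le A B (k : 'I_n) (eps : R) : conj_symmetric A -> conj_symmetric B ->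
  (forall v, qform B v <= qform A v + eps%:C * qform 1%:M v) ->
  eigenvalue_nth k B <= eigenvalue_nth k A + eps.
Proof.
move=> hA hB AB; rewrite /eigenvalue_nth.
apply: nth_count_le; first exact: sorted_eigenvalues.
set x := (eigenvalues A)`_k.
apply: leq_trans (leq_count_eigenvalues (x := x) hA hB _); last first.
  by move=> v; rewrite lerBlDr rmorphD mulrDl addrA subrK.
rewrite ltnNge; apply/negP => kx.
have := @nth_count_gt _ _ x 0 _ k (sorted_eigenvalues A).
by rewrite size_eigenvalues // kx ltn_ord => /(_ isT); rewrite ltxx.
Qed.

Lemma qform1E v : qform 1%:M v = \sum_i `|v 0 i| ^+ 2.
Proof.
by rewrite /qform mulmx1 mxE; apply: eq_bigr => i _; rewrite !mxE normCK.
Qed.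

(** Each cross term |v_i| |v_j| is at most (|v_i|^2 + |v_j|^2) / 2; summing over the
    n^2 pairs gives the factor n. *)
Lemma qform_le_entries A B v (eps : R) : conj_symmetric A -> conj_symmetric B ->
  (forall i j, `|B i j - A i j| <= eps%:C) ->
  qform B v <= qform A v + (eps *+ n)%:C * qform 1%:M v.
Proof.
move=> hA hB BA; rewrite -lerBlDl.
have qE D w : qform D w = \sum_i \sum_j w 0 j * D j i * Num.conj (w 0 i).
  rewrite /qform mxE; apply: eq_bigr => i _; rewrite !mxE mulr_suml.
  by [].
have -> : qform B v - qform A v = \sum_i \sum_j v 0 j * (B j i - A j i) * Num.conj (v 0 i).
  rewrite !qE -sumrB; apply: eq_bigr => i _; rewrite -sumrB.
  by apply: eq_bigr => j _; rewrite mulrBr mulrBl.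
apply: le_trans (real_ler_norm _) _.
  rewrite CrealE; apply/eqP; rewrite rmorph_sum /= exchange_big /=.
  apply: eq_bigr => i _; rewrite rmorph_sum; apply: eq_bigr => j _ /=.
  by rewrite !rmorphM rmorphB /= conjCK -hA -hB mulrAC [RHS]mulrC mulrA mulrAC.
apply: le_trans (ler_norm_sum _ _ _) _.
have two_halves (K : numFieldType) (a b c : K) : a * (b * c + b * c) / 2 = b * a * c.
  by field.
have S2 : \sum_(i < n) \sum_(j < n) (eps%:C * (`|v 0 j| ^+ 2 + `|v 0 i| ^+ 2) / 2)
   = (eps *+ n)%:C * qform 1%:M v.
  under eq_bigr do rewrite -mulr_suml -mulr_sumr big_split /= sumr_const card_ord -qform1E.
  rewrite -mulr_suml -mulr_sumr big_split /= sumr_const card_ord sumrMnl -qform1E.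
  rewrite rmorphMn /= -[_%:C *+ n]mulr_natl -[qform _ _ *+ n]mulr_natl.
  exact: two_halves.
rewrite -S2; apply: ler_sum => i _; apply: le_trans (ler_norm_sum _ _ _) _.
apply: ler_sum => j _; rewrite !normrM norm_conjC mulrAC [_ * `|B _ _ - _|]mulrC -mulrA.
apply: ler_pM; rewrite ?mulr_ge0 //.
rewrite ler_pdivlMr ?ltr0n // -subr_ge0.
have -> : `|v 0 j| ^+ 2 + `|v 0 i| ^+ 2 - `|v 0 j| * `|v 0 i| * 2 = (`|v 0 j| - `|v 0 i|) ^+ 2.
  by rewrite sqrrB mulr_natr addrAC.
by rewrite -realEsqr realB ?normr_real.
Qed.

(** Weyl's inequality.  It controls the eigenvalue of a fixed rank k, so that the
    k-th eigenvalue of a family is Lipschitz even where eigenvalues cross. *)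
Theorem weyl_entries A B (k : 'I_n) (eps : R) : conj_symmetric A -> conj_symmetric B ->
  (forall i j, `|B i j - A i j| <= eps%:C) ->
  `|eigenvalue_nth k B - eigenvalue_nth k A| <= eps *+ n.
Proof.
move=> hA hB BA; rewrite ler_distlC; apply/andP; split.
  by rewrite lerBlDr; apply: eigenvalue_nth_le => // v; apply: qform_le_entries.
apply: eigenvalue_nth_le => // v.
by apply: qform_le_entries => // i j; rewrite distrC.
Qed.

Lemma eigenvalue_nth_eigenvector A (k : 'I_n) : conj_symmetric A ->
  exists2 x : 'cV[C]_n, x != 0 & A *m x = (eigenvalue_nth k A)%:C *: x.
Proof.
move=> hA; have : eigenvalue_nth k A \in eigenvalues A.
  by rewrite mem_nth // size_eigenvalues.
rewrite (perm_mem (perm_eigenvalues hA)) => /mapP[i _ ->].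
rewrite real_spectrumE //.
have /hermitian_normal/hermitian_normalmx/orthomx_spectralP AE := hA.
exists (col i (invmx (spectralmx A))).
  apply/eqP => /(congr1 (mulmx (spectralmx A))); rewrite mulmx0 colE mulmxA.
  rewrite mulmxV ?spectral_unit // mul1mx => /colP/(_ i)/eqP.
  by rewrite !mxE !eqxx oner_eq0.
rewrite {1}AE colE -!mulmxA (mulmxA (spectralmx A)) mulmxV ?spectral_unit //.
rewrite mul1mx scalemxAr; congr (_ *m _).
apply/colP => j; rewrite mul_diag_mx !mxE.
by case: eqP => [->|] //; rewrite !mulr0.
Qed.

End HermitianSpectrum.

(** * Norms, limits and derivatives of matrices *)

Section MatrixCalculus.
Variable R : realType.

Lemma norm_mxE m n (A : 'M[R]_(m, n)) : `|A| = \big[Order.max/0]_ij `|A ij.1 ij.2|.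
Proof. exact: mx_normrE. Qed.

Lemma mx_norm_leP m n (A : 'M[R]_(m, n)) (c : R) : 0 <= c ->
  (forall i j, `|A i j| <= c) -> `|A| <= c.
Proof.
move=> c0 Ac; rewrite norm_mxE.
by apply/bigmax_leP; split=> // -[i j] _; apply: Ac.
Qed.

Lemma entry_le_norm m n (A : 'M[R]_(m, n)) i j : `|A i j| <= `|A|.
Proof.
rewrite norm_mxE.
by apply: (le_bigmax _ (fun ij : 'I_m * 'I_n => `|A ij.1 ij.2|) (i, j)).
Qed.

Lemma norm_mulmx m n p (A : 'M[R]_(m, n)) (B : 'M[R]_(n, p)) :
  `|A *m B| <= n%:R * `|A| * `|B|.
Proof.
apply: mx_norm_leP => [|i j]; first by rewrite !mulr_ge0.
rewrite mxE; apply: le_trans (ler_norm_sum _ _ _) _.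
rewrite -mulrA mulr_natl -[X in _ *+ X](card_ord n) -sumr_const.
by apply: ler_sum => k _; rewrite normrM ler_pM ?entry_le_norm.
Qed.

Lemma dotvE m (x y : 'cV[R]_m) : dotv x y = (x^T *m y) 0 0.
Proof. by rewrite mxE; apply: eq_bigr => i _; rewrite mxE. Qed.

Lemma dotvC m (x y : 'cV[R]_m) : dotv x y = dotv y x.
Proof. by apply: eq_bigr => i _; rewrite mulrC. Qed.

Lemma dotvDr m (x y z : 'cV[R]_m) : dotv x (y + z) = dotv x y + dotv x z.
Proof. by rewrite !dotvE mulmxDr mxE. Qed.

Lemma dotvBr m (x y z : 'cV[R]_m) : dotv x (y - z) = dotv x y - dotv x z.
Proof. by rewrite !dotvE mulmxBr !mxE. Qed.

Lemma dotvZr m (x y : 'cV[R]_m) a : dotv x (a *: y) = a * dotv x y.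
Proof. by rewrite !dotvE -scalemxAr mxE. Qed.

Lemma dotvDl m (x y z : 'cV[R]_m) : dotv (x + y) z = dotv x z + dotv y z.
Proof. by rewrite !(dotvC _ z) dotvDr. Qed.

Lemma dotvBl m (x y z : 'cV[R]_m) : dotv (x - y) z = dotv x z - dotv y z.
Proof. by rewrite !(dotvC _ z) dotvBr. Qed.

Lemma dotvZl m (x y : 'cV[R]_m) a : dotv (a *: x) y = a * dotv x y.
Proof. by rewrite !(dotvC _ y) dotvZr. Qed.

Lemma dotv_mulmx m n (A : 'M[R]_(m, n)) x y : dotv x (A *m y) = dotv (A^T *m x) y.
Proof. by rewrite !dotvE trmx_mul trmxK mulmxA. Qed.

Lemma dotv_eq0 m (x : 'cV[R]_m) : (dotv x x == 0) = (x == 0).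
Proof.
apply/eqP/eqP => [/psumr_eq0P x0|->]; last first.
  by rewrite /dotv big1 // => i _; rewrite mxE mul0r.
apply/colP => i; rewrite mxE; apply/eqP; rewrite -sqrf_eq0 expr2.
by rewrite x0 // => j _; rewrite -expr2 sqr_ge0.
Qed.

Lemma norm_dotv m (x y : 'cV[R]_m) : `|dotv x y| <= m%:R * `|x| * `|y|.
Proof.
rewrite dotvE (le_trans (entry_le_norm _ _ _)) // (le_trans (norm_mulmx _ _)) //.
apply: ler_wpM2r => //; apply: ler_wpM2l => //.
by apply: mx_norm_leP => // i j; rewrite mxE entry_le_norm.
Qed.

Lemma cvg_entry (T : Type) (G : set_system T) {FG : Filter G} m n
    (f : T -> 'M[R]_(m, n)) (A : 'M[R]_(m, n)) i j :
  f x @[x --> G] --> A -> f x i j @[x --> G] --> A i j.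
Proof.
by move=> fA; apply: (@cvg_comp _ _ _ f (fun B : 'M[R]_(m, n) => B i j) G _ _ fA); exact: coord_continuous.
Qed.

Lemma cvg_dotv_mulmx (T : Type) (G : set_system T) {FG : Filter G} m n
    (u : T -> 'cV[R]_m) (A : T -> 'M[R]_(m, n)) (v : T -> 'cV[R]_n)
    (u0 : 'cV[R]_m) (A0 : 'M[R]_(m, n)) (v0 : 'cV[R]_n) :
  u x @[x --> G] --> u0 -> A x @[x --> G] --> A0 -> v x @[x --> G] --> v0 ->
  dotv (u x) (A x *m v x) @[x --> G] --> dotv u0 (A0 *m v0).
Proof.
move=> uu AA vv; apply: (cvg_big (op := +%R) (x0 := 0)).
  exact: add_continuous.
move=> i _; apply: cvgM; first exact: cvg_entry.
under eq_cvg do rewrite mxE; rewrite mxE.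
apply: (cvg_big (op := +%R) (x0 := 0)); first exact: add_continuous.
by move=> j _; apply: cvgM; apply: cvg_entry.
Qed.

Lemma cvg_dotv (T : Type) (G : set_system T) {FG : Filter G} m
    (u v : T -> 'cV[R]_m) (u0 v0 : 'cV[R]_m) :
  u x @[x --> G] --> u0 -> v x @[x --> G] --> v0 ->
  dotv (u x) (v x) @[x --> G] --> dotv u0 v0.
Proof.
move=> uu vv; rewrite -[v0]mul1mx; under eq_cvg do rewrite -[v _]mul1mx.
by apply: cvg_dotv_mulmx => //; exact: cvg_cst.
Qed.

(** The form in which all limits at 0 below are obtained from explicit bounds. *)
Lemma cvg_dist_linear (V : normedModType R) (f : R -> V) (l : V) (c : R) :
  (\forall t \near (0 : R)^', `|f t - l| <= c * `|t|) ->
  f t @[t --> (0 : R)^'] --> l.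
Proof.
move=> fl; apply/cvgrPdist_le => e e0; near=> t.
have ft : `|f t - l| <= c * `|t| by near: t.
rewrite distrC (le_trans ft) // (@le_trans _ _ ((`|c| + 1) * `|t|)) //.
  by rewrite ler_wpM2r // (le_trans (ler_norm _)) // lerDl.
rewrite mulrC -ler_pdivlMr; last by rewrite ltr_wpDl.
near: t; apply: dnbhs0_le.
by rewrite divr_gt0 // ltr_wpDl.
Unshelve. all: by end_near. Qed.

Lemma is_derive_at0P (V : normedModType R) (f : R -> V) (df : V) :
  is_derive (0 : R) (1 : R) f df <->
  h^-1 *: (f h - f 0) @[h --> (0 : R)^'] --> df.
Proof.
have E : (fun h : R => h^-1 *: ((f \o shift 0) (h *: 1) - f 0)) =
         (fun h : R => h^-1 *: (f h - f 0)).
  by apply/funext => h /=; rewrite addr0 /GRing.scale /= mulr1.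
split=> [[fd <-]|fd].
  by move: fd; rewrite /derivable /derive E.
apply: DeriveDef; first by rewrite /derivable E; apply/cvg_ex; exists df.
by rewrite /derive E; apply/cvg_lim.
Qed.

End MatrixCalculus.

Lemma critical_point_quadratic (R : realType) p (F : 'cV[R]_p -> R) (c r : R) :
  0 < r -> (forall a, `|a| < r -> `|F a - F 0| <= c * `|a| ^+ 2) ->
  critical_point F 0.
Proof.
move=> r0 Fc.
have Fo : F \o shift 0 = cst (F 0) + (\0 : {linear 'cV[R]_p -> R}) +o_ (0 : 'cV[R]_p) id.
  apply/eqaddoP => e e0; near=> a.
  have ar : `|a| < r by near: a; exact: (@nbhs0_lt _ 'cV[R]_p).
  have ae : `|a| <= e / (`|c| + 1).
    by near: a; apply: (@nbhs0_le _ 'cV[R]_p); rewrite divr_gt0 // ltr_wpDl.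
  rewrite /= /shift /= !fctE /= addr0 addr0 (le_trans (Fc _ ar)) //.
  rewrite expr2 mulrA ler_wpM2r //.
  rewrite (@le_trans _ _ ((`|c| + 1) * `|a|)) //.
    by rewrite ler_wpM2r // (le_trans (ler_norm _)) // lerDl.
  by rewrite mulrC -ler_pdivlMr // ltr_wpDl.
have c0 : continuous (\0 : {linear 'cV[R]_p -> R}).
  exact: (@cst_continuous 'cV[R]_p R 0).
have dF := diff_unique c0 Fo.
split; last by rewrite dF.
by apply/diff_locallyP; rewrite dF; split.
Unshelve. all: by end_near. Qed.

(** * Perturbation of an eigenvector of a symmetric matrix *)

Section Perturbation.
Variables (R : realType) (p m : nat).
Variables (M : 'cV[R]_p -> 'M[R]_m) (F : 'cV[R]_p -> R) (phi : 'cV[R]_p -> 'cV[R]_m).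
Variables (T : 'M[R]_m) (K rho : R).

(** Coercivity of A - f on the kernel of T0, uniformly for (A, f) close to
    (M0, f0): there A - f differs from the invertible matrix M0 - f0 + T0 by at
    most (m + 1) e, which is absorbed by the left-hand side. *)
Lemma resolvent_bound (M0 T0 : 'M[R]_m) (f0 : R) : M0 - f0%:M + T0 \in unitmx ->
  exists2 c : R, 0 < c & forall A f (x : 'cV[R]_m) e,
    `|A - M0| <= e -> `|f - f0| <= e -> c * e <= 2^-1 ->
    T0 *m x = 0 -> `|x| <= c * `|A *m x - f *: x|.
Proof.
set N := _ + T0 => Nu; pose c0 := m%:R * `|invmx N|; pose c1 : R := m%:R + 1.
have c00 : 0 <= c0 by rewrite mulr_ge0.
have c10 : 1 <= c1 by rewrite lerDr.
exists (2 * c0 * c1 + 1); first by rewrite ltr_wpDl // !mulr_ge0 // (le_trans _ c10).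
move=> A f x e Ae fe ce Tx.
have e0 : 0 <= e by rewrite (le_trans _ Ae).
set w := A *m x - f *: x.
have Nx : N *m x = w - ((A - M0) *m x - (f - f0) *: x).
  rewrite /N mulmxDl Tx addr0 mulmxBl mul_scalar_mx mulmxBl scalerBl /w.
  by apply/colP => i; rewrite !mxE; ring.
have x1 : `|x| <= c0 * `|N *m x|.
  by rewrite -{1}(mulKmx Nu x) norm_mulmx.
have x2 : `|N *m x| <= `|w| + c1 * e * `|x|.
  rewrite Nx (le_trans (ler_normB _ _)) // lerD2l (le_trans (ler_normB _ _)) //.
  rewrite /c1 mulrDl mul1r mulrDl lerD //; last by rewrite mx_normZ ler_wpM2r.
  by rewrite (le_trans (norm_mulmx _ _)) // ler_wpM2r // ler_wpM2l.
have x3 : `|x| <= c0 * `|w| + (c0 * c1 * e) * `|x|.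
  by rewrite (le_trans x1) // (le_trans (ler_wpM2l c00 x2)) // mulrDr !mulrA.
have x4 : c0 * c1 * e <= 2^-1 * 2^-1 by nra.
have x5 : (c0 * c1 * e) * `|x| <= 2^-1 * 2^-1 * `|x| by rewrite ler_wpM2r.
have w0 : 0 <= c0 * `|w| by rewrite mulr_ge0.
have : `|x| <= 2 * (c0 * `|w|) by lra.
move=> /le_trans; apply; rewrite mulrA ler_wpM2r //.
have : c0 <= c0 * c1 by rewrite ler_peMr.
by move=> ?; rewrite -mulrA; lra.
Qed.

(* [phi] is a branch of eigenvectors of the family [M] for the eigenvalue [F].
   The condition [phi_T], with [T] in the role of the orthogonal projection onto
   the eigenspace at 0, fixes the normalization; in the realification below the
   eigenvalue is double and [T] has rank 2. *)
Hypothesis K_gt0 : 0 < K.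
Hypothesis rho_gt0 : 0 < rho.
Hypothesis M_lip : forall a b, `|M a - M b| <= K * `|a - b|.
Hypothesis F_lip : forall a b, `|F a - F b| <= K * `|a - b|.
Hypothesis M_sym : forall a, (M a)^T = M a.
Hypothesis phi_eig : forall a, `|a| < rho -> M a *m phi a = F a *: phi a.
Hypothesis phi_T : forall a, `|a| < rho -> T *m phi a = T *m phi 0.
Hypothesis N_unit : M 0 - (F 0)%:M + T \in unitmx.
Hypothesis T_sym : T^T = T.
Hypothesis T_phi0 : T *m phi 0 = phi 0.
Hypothesis phi0_unit : dotv (phi 0) (phi 0) = 1.

(** The difference x = phi a - phi b is killed by T, and (M a - F a) x is the error
    made by phi b as an eigenvector of M a, which is of order |a - b|; conclude by
    [resolvent_bound]. *)
Lemma eigenvector_lipschitz : exists L r : R, [/\ 0 < r, r <= rho &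
  forall a b, `|a| < r -> `|b| < r -> `|phi a - phi b| <= L * `|a - b|].
Proof.
have [c c0 cP] := resolvent_bound N_unit.
pose c1 : R := m%:R + 1; pose D := c * c1 * K.
have c10 : 1 <= c1 by rewrite lerDr.
have D0 : 0 <= D by rewrite !mulr_ge0 ?(ltW c0) ?(ltW K_gt0) ?(le_trans _ c10).
have cK0 : 0 < c * K by rewrite mulr_gt0.
(* The bound 2^-1 / (c K) is the smallness required by [cP]; the bound 1 keeps
   |phi b| at most (1 + D) |phi 0|. *)
pose r := Num.min rho (Num.min (2^-1 / (c * K)) 1).
have r0 : 0 < r by rewrite !lt_min rho_gt0 ltr01 divr_gt0 ?invr_gt0.
have main a b : `|a| < r -> `|b| < r -> `|phi a - phi b| <= D * `|a - b| * `|phi b|.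
  rewrite !lt_min => /and3P[ar ac _] /and3P[br _ _].
  have Tx : T *m (phi a - phi b) = 0 by rewrite mulmxBr !phi_T // subrr.
  have /cP H : `|M a - M 0| <= K * `|a| by rewrite (le_trans (M_lip _ _)) ?subr0.
  have {}H := H (F a) (phi a - phi b).
  have {H} := H _ _ Tx; rewrite (le_trans (F_lip _ _)) ?subr0 // mulrA.
  rewrite mulrC -ler_pdivlMr // ltW // => /(_ isT isT) /le_trans; apply.
  rewrite /D -!mulrA ler_wpM2l ?(ltW c0) //.
  have -> : M a *m (phi a - phi b) - F a *: (phi a - phi b)
     = (F a - F b) *: phi b - (M a - M b) *m phi b.
    rewrite mulmxBr phi_eig // scalerBr mulmxBl phi_eig // scalerBl.
    by apply/colP => i; rewrite !mxE; ring.
  rewrite (le_trans (ler_normB _ _)) // /c1 addrC mulrDl mul1r lerD //.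
    rewrite (le_trans (norm_mulmx _ _)) // -!mulrA ler_wpM2l // mulrA ler_wpM2r //.
  by rewrite mx_normZ mulrA ler_wpM2r.
have b0 b : `|b| < r -> `|phi b| <= (1 + D) * `|phi 0|.
  move=> br; rewrite -{1}(subrK (phi 0) (phi b)) (le_trans (ler_normD _ _)) //.
  rewrite mulrDl mul1r addrC lerD2l (le_trans (main _ _ br _)) ?normr0 //.
  rewrite subr0 ler_wpM2r // ler_piMr //.
  by move: br; rewrite !lt_min => /and3P[_ _ /ltW].
exists (D * ((1 + D) * `|phi 0|)), r; split=> //.
- by rewrite ge_min lexx.
- move=> a b ar br; rewrite (le_trans (main _ _ ar br)) // mulrAC.
  by rewrite ler_wpM2r // ler_wpM2l // b0.
Qed.

Lemma dotv_phi0 a : `|a| < rho -> dotv (phi 0) (phi a) = 1.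
Proof.
move=> ar; rewrite -{1}T_phi0 -{1}T_sym -dotv_mulmx phi_T // T_phi0.
exact: phi0_unit.
Qed.

Lemma dotv_phi_neq0 a : `|a| < rho -> dotv (phi a) (phi a) != 0.
Proof.
move=> ar; rewrite dotv_eq0; apply: contra_neq (oner_neq0 R) => pa0.
by rewrite -(dotv_phi0 ar) pa0 dotvE mulmx0 mxE.
Qed.

(** An identity without remainder: it turns continuity of the eigenvector into
    differentiability of the eigenvalue. *)
Lemma eigenvalue_difference a b : `|a| < rho -> `|b| < rho ->
  (F b - F a) * dotv (phi a) (phi b) = dotv (phi a) ((M b - M a) *m phi b).
Proof.
move=> ar br; rewrite mulmxBl dotvBr phi_eig // dotvZr.
by rewrite (dotv_mulmx (M a)) M_sym phi_eig // dotvZl mulrBl.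
Qed.

Section LipschitzBranch.
Variables (L r : R).
Hypothesis r_gt0 : 0 < r.
Hypothesis r_le_rho : r <= rho.
Hypothesis phi_lip :
  forall a b, `|a| < r -> `|b| < r -> `|phi a - phi b| <= L * `|a - b|.

Let ltr_rho x : x < r -> x < rho. Proof. by move=> /lt_le_trans; apply. Qed.

Lemma near_ball (a b : 'cV[R]_p) : `|a| < r -> \forall t \near (0 : R), `|a + t *: b| < r.
Proof.
move=> ar.
have : (fun t : R => `|a + t *: b|) @ (0 : R) --> `|a|.
  rewrite -[in X in _ --> X](addr0 a) -(scale0r b).
  apply: cvg_norm; apply: cvgD; first exact: cvg_cst.
  by apply: cvgZr_tmp; exact: cvg_id.
by move=> /cvgr_lt; apply.
Qed.

Lemma cvg_phi (a b : 'cV[R]_p) : `|a| < r ->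
  phi (a + t *: b) @[t --> (0 : R)^'] --> phi a.
Proof.
move=> ar.
have phi_near : \forall t \near (0 : R)^',
    `|phi (a + t *: b) - phi a| <= L * `|b| * `|t|.
  apply: cvg_within; near=> t.
  have ta : `|a + t *: b| < r by near: t; exact: near_ball.
  rewrite (le_trans (phi_lip ta ar)) //.
  by rewrite addrC addKr mx_normZ mulrA mulrAC.
exact: cvg_dist_linear phi_near.
Unshelve. all: by end_near. Qed.

(** The Hellmann-Feynman formula, by passing to the limit in
    [eigenvalue_difference]. *)
Lemma is_derive_eigenvalue (a b : 'cV[R]_p) (B : 'M[R]_m) : `|a| < r ->
  is_derive (0 : R) (1 : R) (fun t : R => M (a + t *: b)) B ->
  is_derive (0 : R) (1 : R) (fun t : R => F (a + t *: b))
    (dotv (phi a) (B *m phi a) / dotv (phi a) (phi a)).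
Proof.
move=> ar /is_derive_at0P MB; apply/is_derive_at0P.
have phi_cvg := cvg_phi b ar.
have den0 := dotv_phi_neq0 (ltr_rho ar).
have den : dotv (phi a) (phi (a + t *: b)) @[t --> (0 : R)^'] --> dotv (phi a) (phi a).
  by apply: cvg_dotv => //; exact: cvg_cst.
have quo : dotv (phi a) (h^-1 *: (M (a + h *: b) - M (a + 0 *: b)) *m phi (a + h *: b))
    / dotv (phi a) (phi (a + h *: b)) @[h --> (0 : R)^'] -->
    dotv (phi a) (B *m phi a) / dotv (phi a) (phi a).
  apply: cvgM; last exact: cvgV.
  by apply: cvg_dotv_mulmx => //; exact: cvg_cst.
apply: cvg_trans quo; apply: near_eq_cvg; near=> h.
have hr : `|a + h *: b| < r.
  by near: h; apply: nbhs_dnbhs; exact: near_ball.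
have dh : dotv (phi a) (phi (a + h *: b)) != 0.
  by near: h; exact: cvgr_neq0 den den0.
rewrite scale0r addr0 -scalemxAl dotvZr -eigenvalue_difference ?ltr_rho //.
by rewrite mulrA mulfK.
Unshelve. all: by end_near. Qed.

(** Since [B 0] is symmetric and kills [phi 0], its form at phi (h a) equals its
    form at phi (h a) - phi 0, which is O(h^2).  So the
    derivative of the eigenvector does not enter. *)
Lemma is_derive_expectation (a : 'cV[R]_p) (B : R -> 'M[R]_m) (B' : 'M[R]_m) :
  (B 0)^T = B 0 -> B 0 *m phi 0 = 0 ->
  is_derive (0 : R) (1 : R) B B' ->
  is_derive (0 : R) (1 : R)
    (fun s : R => dotv (phi (s *: a)) (B s *m phi (s *: a))
                  / dotv (phi (s *: a)) (phi (s *: a)))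
    (dotv (phi 0) (B' *m phi 0)).
Proof.
move=> B0sym B0phi /is_derive_at0P BB; apply/is_derive_at0P.
have r0 : `|0 : 'cV[R]_p| < r by rewrite normr0.
have phi_cvg : phi (s *: a) @[s --> (0 : R)^'] --> phi 0.
  by have := cvg_phi a r0; under eq_cvg do rewrite add0r.
have den : dotv (phi (s *: a)) (phi (s *: a)) @[s --> (0 : R)^'] --> (1 : R).
  by rewrite -phi0_unit; apply: cvg_dotv.
pose c := m%:R * (L * `|a|) * (m%:R * `|B 0| * (L * `|a|)).
have small : h^-1 * dotv (phi (h *: a)) (B 0 *m phi (h *: a)) @[h --> (0 : R)^'] --> (0 : R).
  apply: (cvg_dist_linear (c := c)); near=> h.
  have h0 : h != 0 by near: h; exact: nbhs_dnbhs_neq.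
  have ha : `|0 + h *: a| < r by near: h; apply: nbhs_dnbhs; exact: near_ball.
  have {ha} chi : `|phi (h *: a) - phi 0| <= L * `|a| * `|h|.
    rewrite add0r in ha.
    by rewrite (le_trans (phi_lip ha r0)) // subr0 mx_normZ mulrA mulrAC.
  set x := phi (h *: a) - phi 0 in chi.
  have -> : dotv (phi (h *: a)) (B 0 *m phi (h *: a)) = dotv x (B 0 *m x).
    rewrite /x mulmxBr B0phi subr0 dotvBl.
    have -> : dotv (phi 0) (B 0 *m phi (h *: a)) = 0.
      by rewrite dotv_mulmx B0sym B0phi dotvC dotvE mulmx0 mxE.
    by rewrite subr0.
  rewrite subr0 normrM normfV ler_pdivrMl ?normr_gt0 //.
  rewrite (le_trans (norm_dotv _ _)) //.
  have -> : `|h| * (c * `|h|) = m%:R * (L * `|a| * `|h|) * (m%:R * `|B 0| * (L * `|a| * `|h|)).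
    by rewrite /c; ring.
  apply: ler_pM => //; first by rewrite ler_wpM2l.
  by rewrite (le_trans (norm_mulmx _ _)) // ler_wpM2l ?mulr_ge0.
have quo : (dotv (phi (h *: a)) ((h^-1 *: (B h - B 0)) *m phi (h *: a))
     + h^-1 * dotv (phi (h *: a)) (B 0 *m phi (h *: a)))
    / dotv (phi (h *: a)) (phi (h *: a)) @[h --> (0 : R)^'] -->
    (dotv (phi 0) (B' *m phi 0) + 0) / 1.
  apply: cvgM; last by apply: cvgV => //; exact: oner_neq0.
  by apply: cvgD => //; exact: cvg_dotv_mulmx.
rewrite addr0 divr1 in quo.
apply: cvg_trans quo; apply: near_eq_cvg; near=> h.
rewrite !scale0r B0phi -scalemxAl dotvZr -mulrDr mulmxBl dotvBr subrK.
by rewrite [dotv (phi 0) 0]dotvE mulmx0 mxE mul0r subr0 /GRing.scale /= mulrA.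
Unshelve. all: by end_near. Qed.

(** In <phi 0, (M a - M 0) phi a>, replacing [phi a] by [phi 0] costs O(|a|^2),
    because both M a - M 0 and phi a - phi 0 are O(|a|). *)
Lemma eigenvalue_quadratic (C : R) :
  (forall a, `|dotv (phi 0) ((M a - M 0) *m phi 0)| <= C * `|a| ^+ 2) ->
  exists c, forall a, `|a| < r -> `|F a - F 0| <= c * `|a| ^+ 2.
Proof.
move=> MC; have r0 : `|0 : 'cV[R]_p| < r by rewrite normr0.
exists (C + m%:R * `|phi 0| * (m%:R * K * L)) => a ar.
have := eigenvalue_difference (ltr_rho r0) (ltr_rho ar).
rewrite dotv_phi0 ?ltr_rho // mulr1 => ->.
rewrite -(subrK (phi 0) (phi a)) mulmxDr addrC dotvDr.
rewrite (le_trans (ler_normD _ _)) // mulrDl lerD //.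
rewrite (le_trans (norm_dotv _ _)) // -[leRHS]mulrA ler_wpM2l ?mulr_ge0 //.
rewrite (le_trans (norm_mulmx _ _)) //.
have -> : m%:R * K * L * `|a| ^+ 2 = m%:R * (K * `|a|) * (L * `|a|) by ring.
apply: ler_pM => //; first by rewrite ler_wpM2l // (le_trans (M_lip _ _)) // subr0.
by rewrite (le_trans (phi_lip ar r0)) // subr0.
Qed.

Lemma hessian_eigenvalue (a1 a2 : 'cV[R]_p) (B : R -> 'M[R]_m) (B' : 'M[R]_m) :
  (forall s : R, is_derive (0 : R) (1 : R) (fun t : R => M (s *: a1 + t *: a2)) (B s)) ->
  (B 0)^T = B 0 -> B 0 *m phi 0 = 0 ->
  is_derive (0 : R) (1 : R) B B' ->
  hessian0_exists F a1 a2 /\ hessian0 F a1 a2 = dotv (phi 0) (B' *m phi 0).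
Proof.
move=> MB B0sym B0phi BB.
have F1 : \forall s \near (0 : R),
    is_derive (0 : R) (1 : R) (fun t : R => F (s *: a1 + t *: a2))
      (dotv (phi (s *: a1)) (B s *m phi (s *: a1)) / dotv (phi (s *: a1)) (phi (s *: a1))).
  have : `|0 : 'cV[R]_p| < r by rewrite normr0.
  move/(near_ball a1); apply: filterS => s; rewrite add0r => sr.
  exact: is_derive_eigenvalue.
have part2 : \forall s \near (0 : R),
    dotv (phi (s *: a1)) (B s *m phi (s *: a1)) / dotv (phi (s *: a1)) (phi (s *: a1))
    = partial2 F a1 a2 s.
  by apply: filterS F1 => s sF; rewrite /partial2 derive1E; apply/esym/derive_val.
have D2 := near_eq_is_derive part2 (is_derive_expectation a1 B0sym B0phi BB).
split; first split.
- by apply: filterS F1 => s; case.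
- by case: D2.
- by rewrite /hessian0 derive1E; apply: derive_val.
Qed.

End LipschitzBranch.

End Perturbation.

(** * Simple eigenvalues *)

Lemma unitmx_of_ker (K : fieldType) n (A : 'M[K]_n) :
  (forall x : 'cV[K]_n, A *m x = 0 -> x = 0) -> A \in unitmx.
Proof.
move=> A0; rewrite -unitmx_tr -row_free_unit -kermx_eq0.
apply/rowV0P => v /sub_kermxP vA; apply: trmx_inj; rewrite trmx0.
by apply: A0; rewrite -[A]trmxK -trmx_mul vA trmx0.
Qed.

(** The matrix determinant lemma, multiplied by a so that it holds in any
    commutative ring.  The determinant of the block matrix [a, u; v, 1], reduced in
    two ways, gives the two sides. *)
Lemma det_scalar_sub_rank1 (A : comNzRingType) (n : nat) (a : A) (u : 'cV[A]_n) (v : 'rV[A]_n) :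
  \det (a%:M - u *m v) * a = a ^+ n * (a - (v *m u)%R 0 0).
Proof.
pose B := block_mx a%:M u v (1%:M : 'M[A]_1).
have -> : \det (a%:M - u *m v) = \det B.
  have := det_mulmx B (block_mx 1%:M 0 (- v) 1%:M).
  rewrite mulmx_block !mulmx1 !mulmx0 !mul1mx addrN add0r add0r mulmxN.
  by rewrite det_ublock det_lblock !det1 !mulr1.
have := det_mulmx B (block_mx 1%:M (- u) 0 a%:M).
rewrite mulmx_block !mulmx1 !mulmx0 !mul1mx !addr0 mul_scalar_mx mul_mx_scalar.
rewrite scalerN addNr mulmxN det_ublock det_lblock !det1 mul1r.
rewrite !det_scalar expr1 => <-.
by rewrite (mx11_scalar (- (v *m u) + _)) det_scalar1 !mxE eqxx mulr1n addrC.
Qed.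

Section SimpleEigenvalue.
Variables (R : realType) (n : nat) (H : 'M[R]_n) (lambda : R) (psi : 'cV[R]_n).
Hypothesis H_sym : H^T = H.
Hypothesis H_psi : H *m psi = lambda *: psi.
Hypothesis psi_unit : dotv psi psi = 1.

(** H - lambda shifted by 1 on the line of psi, where it vanishes, and unchanged
    on the orthogonal complement. *)
Definition regularized : 'M[R]_n := H - lambda%:M + psi *m psi^T.

Lemma mul_psiT (x : 'cV[R]_n) : psi *m psi^T *m x = dotv psi x *: psi.
Proof. by rewrite -mulmxA [psi^T *m x]mx11_scalar mul_mx_scalar dotvE. Qed.

(** The rank-one perturbation moves one copy of the eigenvalue lambda to
    lambda + 1 and keeps all others.  This follows from
    (X - H)(X - lambda - psi psi^T) = (X - lambda)(X - H - psi psi^T). *)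
Lemma char_poly_deflation :
  char_poly H * ('X - lambda%:P - 1) = ('X - lambda%:P) * char_poly (H + psi *m psi^T).
Proof.
pose a := 'X - lambda%:P; pose u := map_mx polyC psi; pose v := map_mx polyC psi^T.
have an0 : a ^+ n != 0 by rewrite expf_neq0 // polyXsubC_eq0.
apply: (mulfI an0).
have vu : (v *m u) 0 0 = 1 by rewrite -map_mxM mxE -dotvE psi_unit.
have HP : map_mx polyC H *m (u *m v) = lambda%:P *: (u *m v).
  by rewrite mulmxA -map_mxM H_psi map_mxZ scalemxAl.
have E : char_poly_mx H *m (a%:M - u *m v) = a *: char_poly_mx (H + psi *m psi^T).
  rewrite /char_poly_mx map_mxD [map_mx _ (psi *m _)]map_mxM -/u -/v.
  rewrite mulmxBr mul_mx_scalar mulmxBl HP mul_scalar_mx -scalerBl -/a.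
  by rewrite -scalerBr opprD addrA.
have := congr1 (fun M => \det M * a) E; rewrite det_mulmx detZ -mulrA.
rewrite det_scalar_sub_rank1 vu /char_poly => E1.
by rewrite mulrCA E1 -/a mulrAC mulrA.
Qed.

(** Counting multiplicities of lambda in [char_poly_deflation]. *)
Lemma regularized_unit : mup lambda (char_poly H) = 1%N -> regularized \in unitmx.
Proof.
move=> mup1; have c0 m (A : 'M[R]_m) : char_poly A != 0.
  by rewrite monic_neq0 // char_poly_monic.
have := congr1 (mup lambda) char_poly_deflation.
have E : 'X - lambda%:P - 1 = 'X - (lambda + 1)%:P.
  by rewrite polyCD opprD addrA.
rewrite E !mupM ?polyXsubC_eq0 // mup1.
have mX (x : R) : mup lambda ('X - x%:P) = (x == lambda) :> nat.
  by have := mup_XsubCX 1 lambda x; rewrite expr1; case: eqP.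
rewrite !mX eqxx -subr_eq0 addrC addKr oner_eq0 addn0.
case=> /esym /eqP; rewrite -leqn0 leqNgt -XsubC_dvd // dvdp_XsubCl.
rewrite unitmxE unitfE; apply: contra => /eqP detN.
rewrite /root /char_poly -horner_evalE -det_map_mx.
have -> : map_mx (horner_eval lambda) (char_poly_mx (H + psi *m psi^T))
    = - (H - lambda%:M + psi *m psi^T).
  apply/matrixP => i j; rewrite /char_poly_mx !mxE /horner_eval.
  by rewrite hornerD hornerN hornerC hornerMn hornerX !opprD opprK addrA [X in _ = X - _]addrC.
by rewrite -scaleN1r detZ [\det _]detN mulr0.
Qed.

Hypothesis N_unit : regularized \in unitmx.

(** The Fredholm alternative for H - lambda; the solution phi is orthogonal to
    psi, so the rank-one term in [regularized] does not act on it. *)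
Lemma resolvent_solvable (w : 'cV[R]_n) : dotv psi w = 0 ->
  exists phi : 'cV[R]_n, H *m phi - lambda *: phi = w.
Proof.
move=> pw; pose phi := invmx regularized *m w.
have Nphi : regularized *m phi = w by rewrite mulKVmx.
have phi0 : dotv psi phi = 0.
  have := congr1 (dotv psi) Nphi.
  rewrite /regularized mulmxDl mul_psiT mulmxBl mul_scalar_mx dotvDr dotvBr.
  rewrite dotv_mulmx H_sym H_psi dotvZl !dotvZr psi_unit mulr1 subrr add0r.
  by rewrite pw.
exists phi; rewrite -[RHS]Nphi /regularized mulmxDl mul_psiT phi0 scale0r addr0.
by rewrite mulmxBl mul_scalar_mx.
Qed.

End SimpleEigenvalue.

(** * Cochains, cycles and the weighted Hodge decomposition *)

Section Cochains.

Local Notation head := Defs.head.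
Local Notation tail := Defs.tail.
Variables (R : realType) (n : nat) (e : rel 'I_n) (O : {set 'I_n * 'I_n}).
Implicit Types (alpha z : 'cV[R]_#|O|) (theta : 'cV[R]_n) (W : 'I_n -> 'I_n -> R).

Lemma cochain_ext_anti alpha u v : cochain_ext alpha v u = - cochain_ext alpha u v.
Proof. by rewrite /cochain_ext opprB. Qed.

Lemma cochain_extD alpha beta u v :
  cochain_ext (alpha + beta) u v = cochain_ext alpha u v + cochain_ext beta u v.
Proof.
rewrite /cochain_ext; under eq_bigr do rewrite mxE.
under [X in _ - X]eq_bigr do rewrite mxE.
by rewrite !big_split /= opprD addrACA.
Qed.

Lemma cochain_extZ (t : R) alpha u v :
  cochain_ext (t *: alpha) u v = t * cochain_ext alpha u v.
Proof.
rewrite /cochain_ext; under eq_bigr do rewrite mxE.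
under [X in _ - X]eq_bigr do rewrite mxE.
by rewrite -!mulr_sumr mulrBr.
Qed.

Lemma cochain_extB alpha beta u v :
  cochain_ext (alpha - beta) u v = cochain_ext alpha u v - cochain_ext beta u v.
Proof. by rewrite cochain_extD -scaleN1r cochain_extZ mulN1r. Qed.

Lemma norm_cochain_ext alpha u v : `|cochain_ext alpha u v| <= (#|O|.*2)%:R * `|alpha|.
Proof.
have S (P : pred 'I_#|O|) : `|\sum_(i | P i) alpha i 0| <= #|O|%:R * `|alpha|.
  rewrite (le_trans (ler_norm_sum _ _ _)) // mulr_natl.
  rewrite -[X in _ *+ X]card_ord -sumr_const [leRHS](bigID P) /=.
  by rewrite ler_wpDr ?sumr_ge0 // ler_sum // => i _; apply: entry_le_norm.
by rewrite (le_trans (ler_normB _ _)) // -addnn natrD mulrDl lerD.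
Qed.

(** Turns sums over neighbours, as produced by matrix products, into sums over
    oriented edges, as in [boundary]. *)
Lemma sum_cochain_ext W alpha u :
  \sum_v W u v * cochain_ext alpha u v
  = \sum_(i | tail i == u) W (tail i) (head i) * alpha i 0
    - \sum_(i | head i == u) W (head i) (tail i) * alpha i 0.
Proof.
have E (f g : 'I_#|O| -> 'I_n) : \sum_v W u v * (\sum_(i | (f i, g i) == (u, v)) alpha i 0)
    = \sum_(i | f i == u) W (f i) (g i) * alpha i 0.
  rewrite [RHS](partition_big g predT) //=; apply: eq_bigr => v _.
  rewrite mulr_sumr; apply: eq_big => [i|i /eqP[-> ->] //].
  by rewrite xpair_eqE.
rewrite -E -(E (@head _ O) (@tail _ O)) -sumrB; apply: eq_bigr => v _.
rewrite -mulrBr /cochain_ext; congr (_ * (_ - _)).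
apply: eq_bigl => i; rewrite {1}[enum_val i]surjective_pairing.
by rewrite !xpair_eqE andbC.
Qed.

Lemma sum2_cochain_ext W alpha :
  \sum_u \sum_v W u v * cochain_ext alpha u v
  = \sum_i (W (tail i) (head i) - W (head i) (tail i)) * alpha i 0.
Proof.
under eq_bigr do rewrite sum_cochain_ext.
rewrite sumrB; under [RHS]eq_bigr do rewrite mulrBl.
rewrite sumrB; congr (_ - _).
  by rewrite [RHS](partition_big (@tail _ O) predT).
by rewrite [RHS](partition_big (@head _ O) predT).
Qed.

Hypothesis graph_e : simple_graph e.
Hypothesis orient_O : orientation e O.

Lemma edge_adj (i : 'I_#|O|) : e (tail i) (head i).
Proof.
by case: orient_O => + _; apply; rewrite -surjective_pairing enum_valP.
Qed.

Lemma sum_enum_val alpha (i : 'I_#|O|) : \sum_(j | enum_val j == enum_val i) alpha j 0 = alpha i 0.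
Proof.
by rewrite (eq_bigl (pred1 i)) ?big_pred1_eq // => j; rewrite (inj_eq enum_val_inj).
Qed.

Lemma sum_enum_val0 alpha uv : uv \notin O -> \sum_(j | enum_val j == uv) alpha j 0 = 0.
Proof.
move=> uvO; rewrite big_pred0 // => j; apply/negP => /eqP juv.
by move: uvO; rewrite -juv enum_valP.
Qed.

Lemma cochain_ext_edge alpha (i : 'I_#|O|) : cochain_ext alpha (tail i) (head i) = alpha i 0.
Proof.
rewrite /cochain_ext -surjective_pairing sum_enum_val sum_enum_val0 ?subr0 //.
case: orient_O => _ /(_ _ _ (edge_adj i)).
by rewrite -surjective_pairing enum_valP; case: (_ \in O).
Qed.

Lemma cochain_ext_nonadj alpha u v : ~~ e u v -> cochain_ext alpha u v = 0.
Proof.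
case: graph_e => esym _; case: orient_O => Oe _ euv.
rewrite /cochain_ext !sum_enum_val0 ?subr0 //; apply: contra euv => /Oe //.
by rewrite esym.
Qed.

Lemma cochain_ext_coboundary theta u v : e u v ->
  cochain_ext (coboundary O theta) u v = theta v 0 - theta u 0.
Proof.
have oriented p q : (p, q) \in O ->
    cochain_ext (coboundary O theta) p q = theta q 0 - theta p 0.
  move=> pqO; have := cochain_ext_edge (coboundary O theta) (enum_rank_in pqO (p, q)).
  by rewrite mxE /tail /head enum_rankK_in.
case: orient_O => _ /[apply].
case: (boolP ((u, v) \in O)) => [uvO _|_ /=]; first exact: oriented.
by move/oriented => vu; rewrite cochain_ext_anti vu opprB.
Qed.

Variables (H : 'M[R]_n) (psi : 'cV[R]_n) (lambda : R).
Hypothesis H_sym : H^T = H.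
Hypothesis H_supp : strictly_supported e H.
Hypothesis H_psi : H *m psi = lambda *: psi.
Hypothesis psi_neq0 : forall u, psi u 0 != 0.

Lemma mulH_coboundary theta u v :
  H u v * cochain_ext (coboundary O theta) u v = H u v * (theta v 0 - theta u 0).
Proof.
case: (boolP (e u v)) => [/cochain_ext_coboundary -> //|euv].
rewrite cochain_ext_nonadj //; case: (eqVneq u v) => [->|uv]; first by rewrite subrr.
by have := H_supp uv; rewrite (negbTE euv) => /negbFE/eqP ->; rewrite !mul0r.
Qed.

Lemma H_symE u v : H u v = H v u. Proof. by rewrite -[in LHS]H_sym mxE. Qed.

(** The conductance of an edge in the network attached to psi, up to sign; see
    [boundary_current]. *)
Definition current_weight (i : 'I_#|O|) : R :=
  psi (tail i) 0 * H (tail i) (head i) * psi (head i) 0.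

Lemma current_weight_neq0 i : current_weight i != 0.
Proof.
rewrite !mulf_neq0 // H_supp ?edge_adj //.
by apply: contraTneq (edge_adj i) => ->; case: graph_e => _ ->.
Qed.

Local Notation r := (edge_weight O H psi).

Lemma edge_weightE i : r 0 i = - (current_weight i)^-1.
Proof. by rewrite mxE. Qed.

(** Up to the factor psi_u, the right-hand side is the first-order part of
    H_alpha applied to psi, divided by i.  So alpha = R z has no first-order
    effect on psi exactly when z is a cycle. *)
Lemma boundary_current alpha z u :
  alpha = diag_mx r *m z ->
  boundary z u 0 = psi u 0 * \sum_v H u v * psi v 0 * cochain_ext alpha u v.
Proof.
move=> az; rewrite mulr_sumr.
under eq_bigr do rewrite mulrA.
rewrite (sum_cochain_ext (fun u v => psi u 0 * (H u v * psi v 0))) mxE [LHS]addrC.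
have za i : current_weight i * alpha i 0 = - z i 0.
  by rewrite az mul_diag_mx mxE edge_weightE mulNr mulrN mulVKf ?current_weight_neq0.
have w1 i : psi (tail i) 0 * (H (tail i) (head i) * psi (head i) 0) = current_weight i.
  by rewrite mulrA.
have w2 i : psi (head i) 0 * (H (head i) (tail i) * psi (tail i) 0) = current_weight i.
  by rewrite H_symE mulrC mulrAC mulrC mulrA.
rewrite -[in RHS]sumrN; congr (_ + _).
  by rewrite -sumrN; apply: eq_bigr => i _; rewrite w1 za.
by apply: eq_bigr => i _; rewrite w2 za opprK.
Qed.

Hypothesis psi_unit : dotv psi psi = 1.
Hypothesis N_unit : regularized H lambda psi \in unitmx.

(** Looking for z as R^-1 (alpha - d theta), the cycle condition at u becomes
    ((H - lambda)(psi theta))_u = w_u, where w_u = sum_v H_uv psi_v alpha_uv; here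
    H psi = lambda psi is used.  By antisymmetry of alpha, w is orthogonal to psi,
    hence the equation has a solution psi theta, and psi has no zero. *)
Lemma weighted_hodge alpha : exists z theta,
  z \in cycle_space R O /\ alpha = diag_mx r *m z + coboundary O theta.
Proof.
pose w : 'cV[R]_n := \col_u \sum_v H u v * psi v 0 * cochain_ext alpha u v.
have psiw : dotv psi w = 0.
  have : dotv psi w = - dotv psi w.
    rewrite {1}/dotv; under eq_bigr do rewrite mxE mulr_sumr.
    rewrite exchange_big -sumrN; apply: eq_bigr => u _ /=.
    rewrite mxE -mulrN -sumrN mulr_sumr; apply: eq_bigr => v _.
    by rewrite cochain_ext_anti H_symE; ring.
  by move/eqP; rewrite -addr_eq0 -mulr2n mulrn_eq0 /= => /eqP.
have [phi phiE] := resolvent_solvable H_sym H_psi psi_unit N_unit psiw.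
pose theta : 'cV[R]_n := \col_u (phi u 0 / psi u 0).
pose z : 'cV[R]_#|O| := \col_i (- current_weight i * (alpha - coboundary O theta) i 0).
have az : alpha - coboundary O theta = diag_mx r *m z.
  apply/colP => i; rewrite mul_diag_mx [RHS]mxE edge_weightE [X in _ * X]mxE.
  by rewrite mulrA mulrNN mulVf ?current_weight_neq0 // mul1r.
exists z, theta; split; last by rewrite -az subrK.
rewrite memv_ker lfunE /=; apply/eqP/colP => u; rewrite (boundary_current u az).
rewrite [RHS]mxE; apply/eqP; rewrite mulf_eq0; apply/orP; right.
under eq_bigr do rewrite cochain_extB mulrBr.
rewrite sumrB subr_eq0; apply/eqP.
have := congr1 (fun M : 'cV_n => M u 0) phiE; rewrite [in RHS]mxE => <-.
have Hpu : \sum_v H u v * psi v 0 = lambda * psi u 0.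
  by have := congr1 (fun M : 'cV_n => M u 0) H_psi; rewrite !mxE.
transitivity (\sum_v (H u v * phi v 0 - H u v * psi v 0 * (phi u 0 / psi u 0))).
  rewrite sumrB -mulr_suml Hpu !mxE; congr (_ - _).
  by rewrite -mulrA [psi _ _ * _]mulrC mulfVK.
apply: eq_bigr => v _; rewrite [RHS]mulrAC mulH_coboundary !mxE.
by rewrite mulrAC -[RHS]mulrA [in RHS]mulrBl mulfVK // mulrBr; congr (_ - _); ring.
Qed.

Lemma dotv_coboundary_cycle theta z : z \in cycle_space R O -> dotv (coboundary O theta) z = 0.
Proof.
rewrite memv_ker lfunE /= => /eqP z0; rewrite dotv_coboundary z0.
by rewrite dotvE mulmx0 mxE.
Qed.

Lemma dotv_diag_sym (d : 'rV[R]_#|O|) x y : dotv (diag_mx d *m x) y = dotv (diag_mx d *m y) x.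
Proof. by rewrite [RHS]dotvC [RHS]dotv_mulmx tr_diag_mx. Qed.

(** Decompose z itself, as a cochain, as R w + d theta; then
    z . z = (R w) . z = (R z) . w = 0. *)
Lemma cycle_form_nondegenerate z : z \in cycle_space R O ->
  (forall w, w \in cycle_space R O -> dotv (diag_mx r *m z) w = 0) -> z = 0.
Proof.
move=> zZ z0; apply/eqP; rewrite -dotv_eq0; apply/eqP.
have [w [theta [wZ zE]]] := weighted_hodge z.
rewrite {1}zE dotvDl (dotv_coboundary_cycle _ zZ) addr0.
by rewrite dotv_diag_sym z0.
Qed.

End Cochains.

(** * Magnetic operators *)

Section RealAnalysis.
Variable R : realType.

Lemma lipschitz1_of_derive (f df : R -> R) :
  (forall x : R, is_derive x (1 : R) f (df x)) -> (forall x, `|df x| <= 1) ->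
  forall x y, `|f x - f y| <= `|x - y|.
Proof.
move=> fdf df1 x y; wlog yx : x y / y <= x.
  by move=> W; case: (leP y x) => [/W //|/ltW /W]; rewrite distrC [leRHS]distrC.
have cf : {within `[y, x], continuous f}.
  apply: continuous_subspaceT => t.
  by apply: differentiable_continuous; apply/derivable1_diffP; case: (fdf t).
have [c _ ->] := MVT_segment yx (fun t _ => fdf t) cf.
by rewrite normrM ler_piMl.
Qed.

Lemma cos_lipschitz (x y : R) : `|cos x - cos y| <= `|x - y|.
Proof. by apply: (lipschitz1_of_derive (@is_derive_cos R)) => t; rewrite normrN sin_max. Qed.

Lemma sin_lipschitz (x y : R) : `|sin x - sin y| <= `|x - y|.
Proof. by apply: (lipschitz1_of_derive (@is_derive_sin R)) => t; rewrite cos_max. Qed.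

Lemma one_sub_cos_le (x : R) : `|cos x - 1| <= `|x| ^+ 2.
Proof.
have cosx : cos `|x| = cos x by case: (ger0P x) => _ //; rewrite cosN.
have cos' t : t \in `]0, `|x|[ -> is_derive t (1 : R) cos (- sin t).
  by move=> _; exact: is_derive_cos.
have cosC : {within `[0, `|x|], continuous (@cos R)}.
  by apply: continuous_subspaceT => t; exact: continuous_cos.
have [c] := MVT_segment (normr_ge0 x) cos' cosC; rewrite in_itv /= => /andP[c0 cx]; rewrite cosx cos0 subr0 => ->.
rewrite normrM normrN normr_id expr2 ler_wpM2r //.
by have := sin_lipschitz c 0; rewrite sin0 !subr0 (ger0_norm c0) => /le_trans; apply.
Qed.

Lemma is_derive_mx m n (M : R -> 'M[R]_(m, n)) (D : 'M[R]_(m, n)) (t : R) :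
  (forall i j, is_derive t (1 : R) (fun s => M s i j) (D i j)) ->
  is_derive t (1 : R) M D.
Proof.
move=> MD; have dM : derivable M t 1 by apply/derivable_mxP => i j; case: (MD i j).
apply: DeriveDef => //; rewrite derive_mx //.
by apply/matrixP => i j; rewrite mxE; apply: derive_val.
Qed.

Lemma is_derive_block_mx n (A B C D : R -> 'M[R]_n) (A' B' C' D' : 'M[R]_n) (t : R) :
  (forall i j, is_derive t (1 : R) (fun s => A s i j) (A' i j)) ->
  (forall i j, is_derive t (1 : R) (fun s => B s i j) (B' i j)) ->
  (forall i j, is_derive t (1 : R) (fun s => C s i j) (C' i j)) ->
  (forall i j, is_derive t (1 : R) (fun s => D s i j) (D' i j)) ->
  is_derive t (1 : R) (fun s => block_mx (A s) (B s) (C s) (D s)) (block_mx A' B' C' D').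
Proof.
move=> dA dB dC dD; apply: is_derive_mx => i j; rewrite -(splitK i) -(splitK j).
case: (fintype.split i) => {}i; case: (fintype.split j) => {}j /=.
- by rewrite block_mxEul; under eq_fun do rewrite block_mxEul.
- by rewrite block_mxEur; under eq_fun do rewrite block_mxEur.
- by rewrite block_mxEdl; under eq_fun do rewrite block_mxEdl.
- by rewrite block_mxEdr; under eq_fun do rewrite block_mxEdr.
Qed.

Lemma norm_block_mx n (A B C D : 'M[R]_n) (c : R) : 0 <= c ->
  `|A| <= c -> `|B| <= c -> `|C| <= c -> `|D| <= c -> `|block_mx A B C D| <= c.
Proof.
move=> c0 Ac Bc Cc Dc; apply: mx_norm_leP => // i j.
rewrite -(splitK i) -(splitK j).
by case: (fintype.split i) => {}i; case: (fintype.split j) => {}j /=;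
  rewrite ?(block_mxEul, block_mxEur, block_mxEdl, block_mxEdr) (le_trans (entry_le_norm _ _ _)).
Qed.

End RealAnalysis.


Section Realification.

Local Open Scope complex_scope.
Variables (R : realType).

(** The real form of the complex matrix A + i B. *)
Definition re_im_mx n (A B : 'M[R]_n) : 'M[R]_(n + n) := block_mx A (- B) B A.
Definition re_im_col n (v : 'cV[R[i]]_n) : 'cV[R]_(n + n) :=
  col_mx (map_mx (@complex.Re R) v) (map_mx (@complex.Im R) v).

Lemma re_im_mul n (A : 'M[R[i]]_n) v :
  re_im_mx (map_mx (@complex.Re R) A) (map_mx (@complex.Im R) A) *m re_im_col v
  = re_im_col (A *m v).
Proof.
rewrite /re_im_mx /re_im_col mul_block_col; congr col_mx; apply/colP => i.
  rewrite !mxE raddf_sum -big_split; apply: eq_bigr => j _; rewrite !mxE /=.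
  by case: (A i j) (v j 0) => a b [c d] /=; rewrite mulNr.
rewrite !mxE raddf_sum -big_split; apply: eq_bigr => j _; rewrite !mxE /=.
by case: (A i j) (v j 0) => a b [c d] /=; rewrite addrC.
Qed.

Lemma re_im_scale n (t : R) (v : 'cV[R[i]]_n) : re_im_col (t%:C *: v) = t *: re_im_col v.
Proof.
rewrite /re_im_col scale_col_mx; congr col_mx; apply/colP => i; rewrite !mxE.
  by case: (v i 0) => a b /=; rewrite mul0r subr0.
by case: (v i 0) => a b /=; rewrite mul0r addr0.
Qed.

Lemma re_im_eq0 n (v : 'cV[R[i]]_n) : re_im_col v = 0 -> v = 0.
Proof.
rewrite -col_mx0 => /eq_col_mx[re im]; apply/colP => i; rewrite mxE.
move/colP/(_ i): re; move/colP/(_ i): im; rewrite !mxE.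
by case: (v i 0) => a b /= -> ->.
Qed.

End Realification.

Section Magnetic.

Local Open Scope complex_scope.
Variables (R : realType) (n : nat) (e : rel 'I_n) (O : {set 'I_n * 'I_n}).
Variables (H : 'M[R]_n).
Implicit Types (alpha : 'cV[R]_#|O|) (theta : 'cV[R]_n).
Hypothesis graph_e : simple_graph e.
Hypothesis orient_O : orientation e O.
Hypothesis H_sym : H^T = H.
Hypothesis H_supp : strictly_supported e H.

Local Notation ext := (@cochain_ext R n O).

Definition mag_re alpha : 'M[R]_n := \matrix_(u, v) (cos (ext alpha u v) * H u v).
Definition mag_im alpha : 'M[R]_n := \matrix_(u, v) (sin (ext alpha u v) * H u v).
Definition mag_real alpha : 'M[R]_(n + n) := re_im_mx (mag_re alpha) (mag_im alpha).

Definition expi (x : R) : R[i] := cos x +i* sin x.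

Lemma expiD x y : expi (x + y) = expi x * expi y.
Proof. by rewrite /expi cosD sinD /GRing.mul /= [cos x * sin y + _]addrC. Qed.

Lemma expi_neq0 x : expi x != 0.
Proof.
apply/eqP => x0; have := expiD x (- x); rewrite x0 mul0r subrr /expi cos0 sin0.
by move/eqP; rewrite eq_complex /= oner_eq0.
Qed.

(** One formula covers all pairs: off the edges the extended cochain vanishes and
    the phase is 1. *)
Lemma magneticE alpha u v : magnetic e H alpha u v = expi (ext alpha u v) * (H u v)%:C.
Proof.
rewrite mxE; case: ifPn => // /(cochain_ext_nonadj graph_e orient_O) ->.
by rewrite /expi cos0 sin0 mul1r.
Qed.

Lemma magnetic_re alpha : map_mx (@complex.Re R) (magnetic e H alpha) = mag_re alpha.
Proof.
by apply/matrixP => u v; rewrite mxE magneticE !mxE /expi /= mulr0 subr0.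
Qed.

Lemma magnetic_im alpha : map_mx (@complex.Im R) (magnetic e H alpha) = mag_im alpha.
Proof.
by apply/matrixP => u v; rewrite mxE magneticE !mxE /expi /= mulr0 add0r.
Qed.

Lemma magnetic_hermitian alpha : conj_symmetric (magnetic e H alpha).
Proof.
move=> u v; rewrite !magneticE cochain_ext_anti (H_symE H_sym) /expi cosN sinN.
rewrite rmorphM; congr (_ * _); apply/esym/conj_Creal.
by rewrite -complexr0 complex_real.
Qed.

Lemma ext0 u v : ext 0 u v = 0.
Proof. by have := cochain_extZ 0 (0 : 'cV[R]_#|O|) u v; rewrite scale0r mul0r. Qed.

Lemma magnetic0 : magnetic e H (0 : 'cV[R]_#|O|) = map_mx (real_complex R) H.
Proof.
by apply/matrixP => u v; rewrite magneticE ext0 [RHS]mxE /expi cos0 sin0 mul1r.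
Qed.

(** The two operators are conjugate by the diagonal matrix of phases
    exp (i theta_u). *)
Lemma magnetic_gauge alpha theta k :
  eigenvalue_nth k (magnetic e H (alpha + coboundary O theta))
  = eigenvalue_nth k (magnetic e H alpha).
Proof.
pose d : 'rV[R[i]]_n := \row_u expi (theta u 0).
rewrite /eigenvalue_nth /eigenvalues.
suff -> : char_poly (magnetic e H (alpha + coboundary O theta))
  = char_poly (magnetic e H alpha) by [].
apply: (@char_poly_similar _ _ (diag_mx d)).
  rewrite unitmxE unitfE det_diag; apply/prodf_neq0 => i _.
  by rewrite mxE expi_neq0.
apply/matrixP => u v; rewrite mul_diag_mx mul_mx_diag [RHS]mxE [LHS]mxE.
rewrite !magneticE !mxE cochain_extD.
rewrite mulrA -expiD [RHS]mulrAC -expiD.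
have [Huv0|Huv] := eqVneq (H u v) 0; first by rewrite Huv0 !mulr0.
have := mulH_coboundary graph_e orient_O H_supp theta u v; move/(mulfI Huv) => ->.
by congr (expi _ * _); ring.
Qed.

Lemma mag_real_sym alpha : (mag_real alpha)^T = mag_real alpha.
Proof.
rewrite /mag_real /re_im_mx tr_block_mx; congr block_mx; apply/matrixP => u v;
  by rewrite !mxE cochain_ext_anti (H_symE H_sym) ?sinN ?cosN ?mulNr ?opprK.
Qed.

Let c1 : R := (#|O|.*2)%:R.

Lemma mag_entry_lip (f : R -> R) : (forall x y, `|f x - f y| <= `|x - y|) ->
  forall alpha beta u v,
  `|f (ext alpha u v) * H u v - f (ext beta u v) * H u v| <= c1 * `|H| * `|alpha - beta|.
Proof.
move=> flip alpha beta u v; rewrite -mulrBl normrM mulrAC.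
apply: ler_pM => //; last exact: entry_le_norm.
by rewrite (le_trans (flip _ _)) // -cochain_extB norm_cochain_ext.
Qed.

Lemma mag_real_lip alpha beta : `|mag_real alpha - mag_real beta| <= c1 * `|H| * `|alpha - beta|.
Proof.
rewrite /mag_real /re_im_mx opp_block_mx add_block_mx.
have c0 : 0 <= c1 * `|H| * `|alpha - beta| by rewrite !mulr_ge0.
have re : `|mag_re alpha - mag_re beta| <= c1 * `|H| * `|alpha - beta|.
  apply: mx_norm_leP => // u v; rewrite !mxE.
  exact: (mag_entry_lip (@cos_lipschitz R)).
have im : `|mag_im alpha - mag_im beta| <= c1 * `|H| * `|alpha - beta|.
  apply: mx_norm_leP => // u v; rewrite !mxE.
  exact: (mag_entry_lip (@sin_lipschitz R)).
by apply: norm_block_mx => //; rewrite -opprD normrN.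
Qed.

Lemma eigenvalue_lip (k : 'I_n) alpha beta :
  `|eigenvalue_nth k (magnetic e H alpha) - eigenvalue_nth k (magnetic e H beta)|
  <= n%:R * (c1 * `|H| + c1 * `|H|) * `|alpha - beta|.
Proof.
pose eps := (c1 * `|H| + c1 * `|H|) * `|alpha - beta|.
have := weyl_entries k (A := magnetic e H beta) (B := magnetic e H alpha) (eps := eps).
rewrite -(mulr_natl eps) mulrA; apply; try exact: magnetic_hermitian.
move=> u v.
rewrite [X in `|X|]complexE (le_trans (ler_normD _ _)) // /eps mulrDl rmorphD lerD //.
  rewrite normc_def /= expr0n addr0 sqrtr_sqr lecR.
  rewrite raddfB /= !magneticE /expi /= !mulr0 !subr0.
  exact: (mag_entry_lip (@cos_lipschitz R)).
rewrite normrM [X in X * _]normc_def /= expr0n add0r expr1n sqrtr1 mul1r.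
rewrite normc_def /= expr0n addr0 sqrtr_sqr lecR.
rewrite raddfB /= !magneticE /expi /= !mulr0 !add0r.
exact: (mag_entry_lip (@sin_lipschitz R)).
Qed.

End Magnetic.

(** * Critical point and second derivative *)

Section PhaseDerivatives.
Variable R : realType.

Lemma is_derive_affine (c y t : R) : is_derive t (1 : R) (fun s : R => c + s * y) y.
Proof.
have h : is_derive t (1 : R) (fun s : R => cst c s + y *: s) (0 + y *: 1).
  exact: is_deriveD.
rewrite add0r /GRing.scale /= mulr1 in h.
by under eq_fun => s do rewrite mulrC.
Qed.

Lemma is_derive_phase (f df : R -> R) (c y h t : R) :
  (forall x : R, is_derive x (1 : R) f (df x)) ->
  is_derive t (1 : R) (fun s : R => f (c + s * y) * h) (df (c + t * y) * y * h).
Proof.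
move=> fdf; have d1 := @is_derive1_comp R f (fun s => c + s * y) t _ _ (fdf _) (is_derive_affine c y t).
have h1 : is_derive t (1 : R) (fun s : R => h *: (f \o (fun s => c + s * y)) s) (h *: (df (c + t * y) * y)).
  exact: is_deriveZ.
rewrite /GRing.scale /= mulrC in h1.
by under eq_fun => s do rewrite mulrC.
Qed.

End PhaseDerivatives.


Section MagneticEigenvalue.

Local Open Scope complex_scope.
Variables (R : realType) (n : nat) (e : rel 'I_n) (O : {set 'I_n * 'I_n}).
Variables (H : 'M[R]_n) (k : 'I_n) (psi : 'cV[R]_n).
Local Notation lambda := (eigenvalue_nth k (map_mx (real_complex R) H)).
Local Notation Lambda := (fun alpha : 'cV[R]_#|O| => eigenvalue_nth k (magnetic e H alpha)).
Local Notation r := (edge_weight O H psi).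
Local Notation M := (@mag_real R n O H).
Local Notation ext := (@cochain_ext R n O).
Hypothesis graph_e : simple_graph e.
Hypothesis orient_O : orientation e O.
Hypothesis H_sym : H^T = H.
Hypothesis H_supp : strictly_supported e H.
Hypothesis H_psi : H *m psi = lambda *: psi.
Hypothesis psi_unit : dotv psi psi = 1.
Hypothesis N_unit : regularized H lambda psi \in unitmx.

Lemma Lambda0 : Lambda 0 = lambda.
Proof. by rewrite /= magnetic0. Qed.

Definition psi_col : 'cV[R]_(n + n) := col_mx psi 0.
Definition eigen_projector : 'M[R]_(n + n) := re_im_mx (psi *m psi^T) 0.

Lemma dotv_col_mx (a b c d : 'cV[R]_n) : dotv (col_mx a b) (col_mx c d) = dotv a c + dotv b d.
Proof. by rewrite !dotvE tr_col_mx mul_row_col mxE. Qed.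

Lemma re_im_mul_psi_col (A B : 'M[R]_n) : re_im_mx A B *m psi_col = col_mx (A *m psi) (B *m psi).
Proof. by rewrite mul_block_col !mulmx0 !addr0. Qed.

Lemma mag_real0 : M 0 = re_im_mx H 0.
Proof.
rewrite /mag_real; congr re_im_mx; apply/matrixP => u v; rewrite !mxE ext0.
  by rewrite cos0 mul1r.
by rewrite sin0 mul0r.
Qed.

Lemma eigen_projector_sym : eigen_projector^T = eigen_projector.
Proof. by rewrite /eigen_projector /re_im_mx oppr0 tr_block_mx !trmx0 trmx_mul trmxK. Qed.

Lemma eigen_projector_psi_col : eigen_projector *m psi_col = psi_col.
Proof. by rewrite re_im_mul_psi_col mul_psiT psi_unit scale1r mul0mx. Qed.

Lemma psi_col_unit : dotv psi_col psi_col = 1.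
Proof. by rewrite dotv_col_mx psi_unit [dotv 0 0]dotvE mulmx0 mxE addr0. Qed.

Lemma psi_col_eig : M 0 *m psi_col = Lambda 0 *: psi_col.
Proof. by rewrite mag_real0 re_im_mul_psi_col H_psi mul0mx Lambda0 scale_col_mx scaler0. Qed.

(** At 0 the real form is two copies of the original problem. *)
Lemma mag_regularized_unit : M 0 - (Lambda 0)%:M + eigen_projector \in unitmx.
Proof.
have -> : M 0 - (Lambda 0)%:M + eigen_projector = re_im_mx (regularized H lambda psi) 0.
  rewrite mag_real0 /= Lambda0 scalar_mx_block /eigen_projector /re_im_mx opp_block_mx !add_block_mx.
  by rewrite !oppr0 !addr0.
by rewrite /re_im_mx oppr0 unitmxE det_ublock unitrM -unitmxE N_unit.
Qed.

Lemma lipschitz_const : exists K : R, [/\ 0 < K,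
  forall a b, `|M a - M b| <= K * `|a - b| &
  forall a b, `|Lambda a - Lambda b| <= K * `|a - b|].
Proof.
pose c1 : R := (#|O|.*2)%:R * `|H|.
have c10 : 0 <= c1 by rewrite mulr_ge0.
exists (1 + c1 + n%:R * (c1 + c1)); split.
- by rewrite ltr_wpDr ?mulr_ge0 ?addr_ge0 // ltr_wpDr.
- move=> a b; rewrite (le_trans (mag_real_lip _ _ _)) // ler_wpM2r //.
  by rewrite -addrA addrCA lerDl addr_ge0 // mulr_ge0 // addr_ge0.
- move=> a b; rewrite (le_trans (eigenvalue_lip _ _ _ _ _ _)) // ler_wpM2r //.
  by rewrite lerDr addr_ge0.
Qed.

Lemma eigen_projector_re_im (v : 'cV[R[i]]_n) (s := \sum_u (psi u 0)%:C * v u 0) :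
  eigen_projector *m re_im_col v = col_mx (complex.Re s *: psi) (complex.Im s *: psi).
Proof.
rewrite /eigen_projector /re_im_mx oppr0 mul_block_col !mul0mx addr0 add0r !mul_psiT.
congr (col_mx (_ *: _) (_ *: _)); rewrite /s raddf_sum; apply: eq_bigr => u _;
  by rewrite mxE /=; case: (v u 0) => a b /=; rewrite mul0r ?subr0 ?addr0.
Qed.

(** If <psi, v> = 0 for an eigenvector v, then [resolvent_bound] forces v = 0 as
    soon as alpha is small; otherwise v can be divided by this complex number. *)
Lemma normalized_eigenvector : exists2 rho : R, 0 < rho &
  forall alpha, `|alpha| < rho ->
  exists2 y, M alpha *m y = Lambda alpha *: y & eigen_projector *m y = psi_col.
Proof.
have [K [K0 Mlip Flip]] := lipschitz_const.
have [c c0 cP] := resolvent_bound mag_regularized_unit.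
exists (2^-1 / (c * K)); first by rewrite !divr_gt0 ?mulr_gt0 ?invr_gt0.
move=> alpha ar.
have [v v0 vE] := eigenvalue_nth_eigenvector k (magnetic_hermitian graph_e orient_O H_sym alpha).
have ME w : M alpha *m re_im_col w = re_im_col (magnetic e H alpha *m w).
  by rewrite -re_im_mul (magnetic_re _ graph_e orient_O) (magnetic_im _ graph_e orient_O).
pose s := \sum_u (psi u 0)%:C * v u 0.
have s0 : s != 0.
  apply: contra v0 => /eqP s0; apply/eqP/re_im_eq0/normr0_eq0/eqP.
  rewrite eq_le normr_ge0 andbT.
  have Tv : eigen_projector *m re_im_col v = 0.
    by rewrite eigen_projector_re_im -/s s0 /= !scale0r col_mx0.
  have Mv : M alpha *m re_im_col v - Lambda alpha *: re_im_col v = 0.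
    by apply/eqP; rewrite subr_eq0 ME vE re_im_scale.
  have := cP (M alpha) (Lambda alpha) (re_im_col v) (K * `|alpha|).
  rewrite Mv normr0 mulr0; apply; last exact: Tv.
  - by rewrite (le_trans (Mlip _ _)) // subr0.
  - by rewrite (le_trans (Flip _ _)) // subr0.
  - by rewrite mulrA mulrC -ler_pdivlMr ?mulr_gt0 // ltW.
exists (re_im_col (s^-1 *: v)).
  by rewrite ME -scalemxAr vE scalerA mulrC -scalerA re_im_scale.
rewrite eigen_projector_re_im.
have -> : \sum_u (psi u 0)%:C * (s^-1 *: v) u 0 = 1.
  under eq_bigr do rewrite mxE mulrCA.
  by rewrite -mulr_sumr mulVf.
by rewrite /= scale1r scale0r.
Qed.

Lemma eigenvector_branch : exists (phi : 'cV[R]_#|O| -> 'cV[R]_(n + n)) (rho : R),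
  [/\ 0 < rho, phi 0 = psi_col,
    forall a, `|a| < rho -> M a *m phi a = Lambda a *: phi a &
    forall a, `|a| < rho -> eigen_projector *m phi a = eigen_projector *m phi 0].
Proof.
have [rho rho0 ex] := normalized_eigenvector.
have /choice[phi phiP] : forall a : 'cV[R]_#|O|, exists y : 'cV[R]_(n + n),
    (a = 0 -> y = psi_col) /\
    (`|a| < rho -> M a *m y = Lambda a *: y /\ eigen_projector *m y = psi_col).
  move=> a; have [->|a0] := eqVneq a 0.
    by exists psi_col; split=> // _; rewrite psi_col_eig eigen_projector_psi_col.
  case: (boolP (`|a| < rho)) => [/ex[y My Ty]|_]; last first.
    by exists 0; split=> // /eqP; rewrite (negbTE a0).
  by exists y; split=> // /eqP; rewrite (negbTE a0).
have p0 : phi 0 = psi_col by case: (phiP 0) => + _; apply.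
exists phi, rho; split=> // a ar; case: (phiP a) => _ /(_ ar)[] //.
by rewrite p0 eigen_projector_psi_col.
Qed.

(** Only the real part of H_alpha contributes to its form on the real vector psi,
    and it depends on alpha through cosines. *)
Lemma mag_form_quadratic : exists C : R, forall a,
  `|dotv psi_col ((M a - M 0) *m psi_col)| <= C * `|a| ^+ 2.
Proof.
pose c1 : R := (#|O|.*2)%:R.
exists (n%:R * `|psi| * (n%:R * (c1 ^+ 2 * `|H|) * `|psi|)) => a.
have -> : dotv psi_col ((M a - M 0) *m psi_col) = dotv psi ((mag_re H a - H) *m psi).
  rewrite mulmxBl mag_real0 !re_im_mul_psi_col opp_col_mx add_col_mx dotv_col_mx.
  by rewrite mulmxBl [X in _ + X]dotvC [X in _ + X]dotvE mulmx0 mxE addr0.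
rewrite (le_trans (norm_dotv _ _)) // -[leRHS]mulrA ler_wpM2l ?mulr_ge0 //.
rewrite (le_trans (norm_mulmx _ _)) // [leRHS]mulrAC ler_wpM2r // -mulrA ler_wpM2l //.
apply: mx_norm_leP => [|u v]; first by rewrite !mulr_ge0.
rewrite !mxE -[X in _ - X]mul1r -mulrBl normrM mulrAC -exprMn.
apply: ler_pM => //; last exact: entry_le_norm.
rewrite (le_trans (one_sub_cos_le _)) // lerXn2r ?nnegrE ?mulr_ge0 //.
exact: norm_cochain_ext.
Qed.

(** The condition on [a2] says that the derivative of the operator at 0 in the
    direction [a2] kills psi. *)
Theorem critical_and_hessian :
  critical_point Lambda 0 /\
  forall a1 a2 : 'cV[R]_#|O|,
    (forall u, \sum_v H u v * psi v 0 * ext a2 u v = 0) ->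
    hessian0_exists Lambda a1 a2 /\
    hessian0 Lambda a1 a2
    = - \sum_u \sum_v psi u 0 * H u v * psi v 0 * ext a1 u v * ext a2 u v.
Proof.
have [K [K0 Mlip Flip]] := lipschitz_const.
have [phi [rho [rho0 p0 phi_eig phi_T]]] := eigenvector_branch.
have T0 : eigen_projector *m phi 0 = phi 0 by rewrite p0 eigen_projector_psi_col.
have u0 : dotv (phi 0) (phi 0) = 1 by rewrite p0 psi_col_unit.
have Msym := mag_real_sym (O := O) H_sym.
have [L [rr [rr0 rrho phi_lip]]] :=
  eigenvector_lipschitz K0 rho0 Mlip Flip phi_eig phi_T mag_regularized_unit.
split.
  have [C MC] := mag_form_quadratic; rewrite -p0 in MC.
  have [c cP] := eigenvalue_quadratic Mlip Msym phi_eig phi_T eigen_projector_sym T0 u0 rr0 rrho phi_lip MC.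
  exact: critical_point_quadratic cP.
move=> a1 a2 a2H.
pose S s : 'M[R]_n := \matrix_(u, v) (- sin (s * ext a1 u v + 0 * ext a2 u v) * ext a2 u v * H u v).
pose C s : 'M[R]_n := \matrix_(u, v) (cos (s * ext a1 u v + 0 * ext a2 u v) * ext a2 u v * H u v).
pose D : 'M[R]_n := \matrix_(u, v) (- ext a1 u v * ext a2 u v * H u v).
have ext2 s t u v : ext (s *: a1 + t *: a2) u v = s * ext a1 u v + t * ext a2 u v.
  by rewrite cochain_extD !cochain_extZ.
have MB s : is_derive (0 : R) (1 : R) (fun t : R => M (s *: a1 + t *: a2)) (re_im_mx (S s) (C s)).
  have dS u v : is_derive (0 : R) (1 : R) (fun t : R => mag_re H (s *: a1 + t *: a2) u v) (S s u v).
    rewrite mxE; under eq_fun do rewrite mxE ext2.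
    exact: is_derive_phase (@is_derive_cos R).
  have dC u v : is_derive (0 : R) (1 : R) (fun t : R => mag_im H (s *: a1 + t *: a2) u v) (C s u v).
    rewrite mxE; under eq_fun do rewrite mxE ext2.
    exact: is_derive_phase (@is_derive_sin R).
  apply: is_derive_block_mx => // u v; rewrite mxE; under eq_fun do rewrite mxE.
  exact: is_deriveN.
have BD : is_derive (0 : R) (1 : R) (fun s => re_im_mx (S s) (C s)) (re_im_mx D 0).
  have dS u v : is_derive (0 : R) (1 : R) (fun s : R => S s u v) (D u v).
    under eq_fun => s do rewrite mxE mul0r addr0 -mulrA -[s * _]add0r.
    have := @is_derive_phase R (fun x => - sin x) (fun x => - cos x) 0 (ext a1 u v) (ext a2 u v * H u v) 0.
    rewrite mul0r addr0 cos0 mxE mulN1r mulrA; exact.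
  have dC u v : is_derive (0 : R) (1 : R) (fun s : R => C s u v) ((0 : 'M[R]_n) u v).
    under eq_fun => s do rewrite mxE mul0r addr0 -mulrA -[s * _]add0r.
    have := @is_derive_phase R cos (fun x => - sin x) 0 (ext a1 u v) (ext a2 u v * H u v) 0.
    rewrite mul0r addr0 sin0 mxE oppr0 !mul0r; exact.
  apply: is_derive_block_mx => // u v; rewrite mxE; under eq_fun do rewrite mxE.
  exact: is_deriveN.
have S0 : S 0 = 0.
  by apply/matrixP => u v; rewrite !mxE !mul0r addr0 sin0 oppr0 !mul0r.
have C0 u v : C 0 u v = ext a2 u v * H u v.
  by rewrite mxE !mul0r addr0 cos0 mul1r.
have Bsym : (re_im_mx (S 0) (C 0))^T = re_im_mx (S 0) (C 0).
  rewrite S0 /re_im_mx tr_block_mx trmx0; congr block_mx; apply/matrixP => u v.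
    by rewrite mxE [RHS]mxE !C0 cochain_ext_anti (H_symE H_sym) mulNr.
  by rewrite mxE [LHS]mxE !C0 cochain_ext_anti (H_symE H_sym) mulNr opprK.
have Bphi : re_im_mx (S 0) (C 0) *m phi 0 = 0.
  rewrite p0 re_im_mul_psi_col S0 mul0mx -col_mx0; congr col_mx.
  apply/colP => u; rewrite mxE [RHS]mxE -[RHS](a2H u); apply: eq_bigr => v _.
  by rewrite C0 -mulrA mulrC.
have [hex ->] := hessian_eigenvalue Msym phi_eig phi_T eigen_projector_sym T0 u0 rr0 rrho phi_lip MB Bsym Bphi BD.
split=> //; rewrite p0 re_im_mul_psi_col mul0mx dotv_col_mx [X in _ + X]dotvE mulmx0 mxE addr0.
rewrite /dotv -sumrN; apply: eq_bigr => u _; rewrite mxE mulr_sumr -sumrN.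
by apply: eq_bigr => v _; rewrite mxE; ring.
Qed.

End MagneticEigenvalue.

(** * The Hessian and the dual form *)

Lemma hessian0_eq_direction (R : realType) m (F : 'cV[R]_m -> R) (a b1 b2 : 'cV[R]_m) :
  (forall t1 t2 : R, F (t1 *: a + t2 *: b1) = F (t1 *: a + t2 *: b2)) ->
  (hessian0_exists F a b2 -> hessian0_exists F a b1) /\ hessian0 F a b1 = hessian0 F a b2.
Proof.
move=> FE; have line t1 : (fun t2 => F (t1 *: a + t2 *: b1)) = (fun t2 => F (t1 *: a + t2 *: b2)).
  by apply/funext => t2.
have part : partial2 F a b1 = partial2 F a b2.
  by apply/funext => t1; rewrite /partial2 line.
split; last by rewrite /hessian0 part.
rewrite /hessian0_exists part => -[d1 d2]; split=> //.
by apply: filterS d1 => t1; rewrite line.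
Qed.

Section Hessian.
Variables (R : realType) (n : nat) (e : rel 'I_n) (O : {set 'I_n * 'I_n}).
Variables (H : 'M[R]_n) (k : 'I_n) (psi : 'cV[R]_n).
Local Notation lambda := (eigenvalue_nth k (map_mx (real_complex R) H)).
Local Notation Lambda := (fun alpha : 'cV[R]_#|O| => eigenvalue_nth k (magnetic e H alpha)).
Local Notation r := (edge_weight O H psi).
Local Notation Z := (cycle_space R O).
Local Notation X := (cycle_intersection_form r).
Hypothesis graph_e : simple_graph e.
Hypothesis orient_O : orientation e O.
Hypothesis H_sym : H^T = H.
Hypothesis H_supp : strictly_supported e H.
Hypothesis H_psi : H *m psi = lambda *: psi.
Hypothesis psi_unit : dotv psi psi = 1.
Hypothesis psi_neq0 : forall u, psi u 0 != 0.
Hypothesis N_unit : regularized H lambda psi \in unitmx.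

(** The gauge term d theta is dropped, the sum over ordered pairs of vertices
    counts each edge twice, and the weights - psi_u H_uv psi_v cancel those in
    R z. *)
Lemma hessian_cycle (a1 a2 z : 'cV[R]_#|O|) (theta : 'cV[R]_n) : z \in Z ->
  a2 = diag_mx r *m z + coboundary O theta ->
  hessian0_exists Lambda a1 a2 /\ hessian0 Lambda a1 a2 = 2 * dotv a1 z.
Proof.
move=> zZ a2E; pose b := diag_mx r *m z.
have gauge (t1 t2 : R) : Lambda (t1 *: a1 + t2 *: a2) = Lambda (t1 *: a1 + t2 *: b).
  have -> : t1 *: a1 + t2 *: a2 = (t1 *: a1 + t2 *: b) + coboundary O (t2 *: theta).
    by rewrite linearZ a2E scalerDr addrA.
  exact: (magnetic_gauge graph_e orient_O H_supp).
have [exb ->] := @hessian0_eq_direction _ _ Lambda a1 a2 b gauge.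
have cur u : \sum_v H u v * psi v 0 * cochain_ext b u v = 0.
  apply: (mulfI (psi_neq0 u)); rewrite mulr0.
  rewrite -(boundary_current graph_e orient_O H_sym H_supp psi_neq0 u (erefl b)).
  by move: zZ; rewrite memv_ker lfunE /= => /eqP ->; rewrite mxE.
have [_ /(_ a1 b cur)[hex hE]] :=
  critical_and_hessian graph_e orient_O H_sym H_psi psi_unit N_unit.
split; first exact: exb hex.
rewrite hE.
pose W u v := psi u 0 * H u v * psi v 0 * cochain_ext b u v.
have -> : \sum_u \sum_v psi u 0 * H u v * psi v 0 * cochain_ext a1 u v * cochain_ext b u v
   = \sum_u \sum_v W u v * cochain_ext a1 u v.
  by apply: eq_bigr => u _; apply: eq_bigr => v _; rewrite mulrAC.
rewrite sum2_cochain_ext /dotv mulr_sumr -sumrN; apply: eq_bigr => i _.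
rewrite /W (cochain_ext_anti b (Defs.tail i)) !(cochain_ext_edge orient_O).
rewrite (H_symE H_sym (Defs.head i)) /b mul_diag_mx mxE edge_weightE.
have := current_weight_neq0 graph_e orient_O H_supp psi_neq0 i.
rewrite /current_weight => w0; field.
by move: w0; rewrite !mulf_eq0 !negb_or => /andP[/andP[-> ->] ->].
Qed.

Lemma cycle_formE (x y : subvs_of Z) : X x y = dotv (diag_mx r *m vsval x) (vsval y).
Proof. by apply: eq_bigr => i _; rewrite mul_diag_mx [in RHS]mxE. Qed.

Lemma cycle_form_nondeg : nondegenerate_form X.
Proof.
move=> x x0; apply: val_inj => /=.
apply: (cycle_form_nondegenerate graph_e orient_O H_sym H_supp H_psi psi_neq0 psi_unit N_unit).
  exact: subvsP.
by move=> w wZ; have := x0 (vsproj Z w); rewrite cycle_formE vsprojK.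
Qed.

(** The cycle part of the decomposition of [a] is the element that represents its
    class. *)
Lemma sharp_coho (a : 'cV[R]_#|O|) (z : subvs_of Z) (theta : 'cV[R]_n) :
  a = diag_mx r *m vsval z + coboundary O theta ->
  sharp X (coho_dual (coho_class a)) = z.
Proof.
move=> aE.
have fz w : coho_dual (coho_class a) w = X z w.
  rewrite coho_dualE aE dotvDl cycle_formE dotv_coboundary_cycle ?addr0 //.
  exact: subvsP.
apply: xget_unique => [w|y fy]; first exact: fz.
apply/eqP; rewrite -subr_eq0; apply/eqP/cycle_form_nondeg => w.
have yz : vsval (y - z) = vsval y - vsval z by rewrite linearB.
rewrite cycle_formE yz mulmxBr dotvBl -!cycle_formE.
by rewrite -fy -fz subrr.
Qed.

End Hessian.

Theorem theorem1p5 (R : realType) (n : nat) (e : rel 'I_n)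
    (O : {set 'I_n * 'I_n}) (H : 'M[R]_n) (k : 'I_n) (psi : 'cV[R]_n)
    (lambda : R := eigenvalue_nth k (map_mx (real_complex R) H))
    (Lambda : 'cV[R]_#|O| -> R :=
       fun alpha => eigenvalue_nth k (magnetic e H alpha))
    (r : 'rV[R]_#|O| := edge_weight O H psi)
    (X := cycle_intersection_form r) :
  simple_graph e -> orientation e O ->
  H^T = H -> strictly_supported e H ->
  mup lambda (char_poly H) = 1%N ->
  H *m psi = lambda *: psi ->
  dotv psi psi = 1 ->
  (forall u, psi u 0 != 0) ->
  [/\ critical_point Lambda 0,
      (forall a1 a2, hessian0_exists Lambda a1 a2),
      bilinear_for *%R *%R (hessian0 Lambda),
      nondegenerate_form X /\
      (forall a1 a2,
         2^-1 * hessian0 Lambda a1 a2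
         = dual_form X (coho_dual (coho_class a1)) (coho_dual (coho_class a2))) &
      forall C, frame C ->
        C^T *m diag_mx r *m C \in unitmx /\
        forall a1 a2,
          2^-1 * hessian0 Lambda a1 a2
          = dotv a1 (C *m invmx (C^T *m diag_mx r *m C) *m C^T *m a2)].
Proof.
move=> graph_e orient_O H_sym H_supp simple H_psi psi_unit psi_neq0.
have N_unit := regularized_unit H_psi psi_unit simple.
have decomp (a : 'cV[R]_#|O|) : exists (z : subvs_of (cycle_space R O)) theta,
    a = diag_mx r *m vsval z + coboundary O theta.
  have [z [theta [zZ aE]]] :=
    weighted_hodge graph_e orient_O H_sym H_supp H_psi psi_neq0 psi_unit N_unit a.
  by exists (vsproj _ z), theta; rewrite vsprojK.
have hess a1 a2 (z : subvs_of (cycle_space R O)) theta :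
    a2 = diag_mx r *m vsval z + coboundary O theta ->
    hessian0_exists Lambda a1 a2 /\ hessian0 Lambda a1 a2 = 2 * dotv a1 (vsval z).
  by apply: hessian_cycle => //; apply: subvsP.
have sharpE := @sharp_coho R n e O H k psi graph_e orient_O H_sym H_supp H_psi psi_unit psi_neq0 N_unit.
have nondeg := cycle_form_nondeg graph_e orient_O H_sym H_supp H_psi psi_unit psi_neq0 N_unit.
split.
- by have [] := critical_and_hessian graph_e orient_O H_sym H_psi psi_unit N_unit.
- by move=> a1 a2; have [z [theta /(hess a1)[]]] := decomp a2.
- split=> a t x y.
    have [z [theta aE]] := decomp a.
    by rewrite !(hess _ _ _ _ aE).2 dotvDl dotvZl mulrDr mulrCA.
  have [zx [thx xE]] := decomp x; have [zy [thy yE]] := decomp y.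
  have xyE : t *: x + y = diag_mx r *m vsval (t *: zx + zy) + coboundary O (t *: thx + thy).
    by rewrite !linearP /= xE yE scalerDr addrACA scalemxAr.
  rewrite (hess _ _ _ _ xE).2 (hess _ _ _ _ yE).2 (hess _ _ _ _ xyE).2.
  have vE : vsval (t *: zx + zy) = t *: vsval zx + vsval zy by rewrite linearP.
  by rewrite vE dotvDr dotvZr mulrDr mulrCA.
- split=> // a1 a2; have [z1 [th1 E1]] := decomp a1; have [z2 [th2 E2]] := decomp a2.
  rewrite /dual_form (sharpE _ _ _ E1) (sharpE _ _ _ E2) (hess _ _ _ _ E2).2 mulKf ?pnatr_eq0 //.
  by rewrite /X cycle_formE E1 dotvDl dotv_coboundary_cycle ?addr0 //; apply: subvsP.
- move=> C Cf; have /andP[/eqP Cspan Cfree] := Cf.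
  have CE c : C *m c = \sum_j c j 0 *: [tuple col j C | j < \dim (cycle_space R O)]`_j.
    apply/colP => i; rewrite mxE summxE; apply: eq_bigr => j _.
    by rewrite -tnth_nth tnth_mktuple !mxE mulrC.
  have CZ c : C *m c \in cycle_space R O.
    rewrite CE memv_suml // => j _; rewrite memvZ // (basis_mem Cf) // mem_nth //.
    by rewrite size_tuple.
  have Cinj (c : 'cV[R]_(\dim (cycle_space R O))) : C *m c = 0 -> c = 0.
    rewrite CE => c0; apply/colP => j; rewrite mxE.
    by have /freeP/(_ (fun j => c j 0) c0 j) := Cfree.
  have Csurj z : z \in cycle_space R O -> exists c : 'cV[R]_(\dim (cycle_space R O)), z = C *m c.
    move=> zZ; exists (\col_j coord [tuple col j C | j < \dim (cycle_space R O)] j z).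
    rewrite CE {1}(coord_basis Cf zZ); apply: eq_bigr => j _.
    by rewrite mxE.
  have Gunit : C^T *m diag_mx r *m C \in unitmx.
    apply: unitmx_of_ker => c Gc0; apply: Cinj.
    apply: (cycle_form_nondegenerate graph_e orient_O H_sym H_supp H_psi psi_neq0 psi_unit N_unit) => // w /Csurj[d ->].
    by rewrite dotv_mulmx !mulmxA Gc0 dotvC dotvE mulmx0 mxE.
  split=> // a1 a2; have [z [theta aE]] := decomp a2.
  rewrite (hess _ _ _ _ aE).2 mulKf ?pnatr_eq0 //; congr dotv.
  have [c cE] := Csurj _ (subvsP z).
  have Cth : C^T *m coboundary O theta = 0.
    apply/eqP; rewrite -dotv_eq0 dotv_mulmx trmxK dotvC; apply/eqP.
    exact: dotv_coboundary_cycle.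
  have CTa : C^T *m a2 = C^T *m diag_mx r *m C *m c.
    by rewrite aE mulmxDr Cth addr0 cE !mulmxA.
  by rewrite -(mulmxA _ C^T) CTa -(mulmxA C) mulKmx.
Qed.
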